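(* Let $f\colon\mathbb C\to\mathbb C$ be an entire transcendental function, let $\delta\in\mathbb C\setminus\{0\}$, and let $F\colon\mathbb C^2\to\mathbb C^2$ be the transcendental Hénon map $F(z,w)=(f(z)-\delta w,\,z)$. Then $F$ has an escaping orbit, i.e. there exists a point $p\in\mathbb C^2$ with $\|F^n(p)\|\to\infty$ as $n\to\infty$.
   Context: An entire function $f\colon\mathbb C\to\mathbb C$ is transcendental if it is not a polynomial. $F^n$ denotes the $n$-th iterate of $F$. *)

(* Defs.v *)
From Stdlib Require Import Reals.
From Coquelicot Require Import Coquelicot.

Open Scope R_scope.
Open Scope C_scope.

(* [ex_derive] over the scalar ring [C_AbsRing] is complex differentiability
   (not real differentiability on R^2). *)
Definition entire (f : C -> C) : Prop :=
  forall z : C, @ex_derive C_AbsRing C_NormedModule f z.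

Definition is_polynomial (f : C -> C) : Prop :=
  exists (d : nat) (a : nat -> C), forall z : C,
    f z = @sum_n C_AbelianMonoid (fun k => a k * Cpow z k) d.

Definition transcendental_entire (f : C -> C) : Prop :=
  entire f /\ ~ is_polynomial f.

Definition henon (f : C -> C) (delta : C) (p : C * C) : C * C :=
  (f (fst p) - delta * snd p, fst p).

(* Coquelicot's norm on a product is sqrt (|z|^2 + |w|^2), so that this is
   C^2 with its Euclidean norm. *)
Definition C2 : NormedModule C_AbsRing :=
  prod_NormedModule C_AbsRing C_NormedModule C_NormedModule.

Definition escaping (F : C * C -> C * C) (p : C * C) : Prop :=
  is_lim_seq (fun n : nat => @norm C_AbsRing C2 (Nat.iter n F p)) p_infty.

(* Main.v *)
Require Import Defs.
From Stdlib Require Import Reals Lra Lia Psatz ClassicalEpsilon.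
From Coquelicot Require Import Coquelicot.

(** An orbit of the Henon map started at [(z_0, 0)] is a sequence with
    [z_(n+1) + delta z_(n-1) = f z_n].  Let [a] almost maximise
    [|f z| (R - |z|)^L] over [|z| <= R], with [L] a large constant, and put
    [d = R - |a|], [c = L conj(a) / (d |a|)].  Then
    [g s = f (a + s) exp (- c s) / f a] satisfies [g 0 = 1] and is bounded by
    [1 + small] for [|s| <= 12 / |c|], so by Borel--Caratheodory [g] is almost
    constantly [1] on [|s| <= 6 / |c|]: near [a], [f] behaves like the
    exponential [f a exp (c s)] on a disc containing more than a full period.
    Hence for every [a'] with [|f a| / 4 <= |a'| <= |f a|] there is a tiny disc
    near [a] on which [f] is almost affine with huge slope [a' c] and covers a
    disc around [a'] of radius proportional to [|a'|].  Since [f] grows faster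
    than any polynomial, [|a| >= R / 4] for large [R], so [a'] can be taken to be
    the point associated with the radius [R' = |f a|].  Iterating gives
    discs tending to infinity, and a contraction argument on the whole sequence
    [(z_n)] at once yields an orbit with [z_n] in the [n]-th disc. *)

Local Open Scope R_scope.

(** * The complex exponential, continuity and differentiability *)

(** The exponent [c s] comes from the weight: moving from [a] by [s] changes [L ln (R - |z|)] by
    about [- Re (c s)], so near-maximality of the product gives [|f (a + s)| <= (1 + small) |f a|
    exp (Re (c s))]. The error is of second order, hence of size [1 / L] at the scale
    [1 / |c| = d / L], so a large fixed [L] suffices. The radii come from the logarithm of
    [a' / f a]: its real part is at most 3/2 in modulus and its imaginary part at most [PI <= 4], so
    every target is met within 11/2 < 6 units of [1 / |c|]; Borel--Caratheodory costs half the
    radius, whence 12. The recurrence is of second order, so discs cannot simply be pulled back one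
    at a time; a contraction on whole sequences treats [z_(n+1)] and [delta z_(n-1)] together, the
    latter being absorbed because [|f a|] exceeds a large multiple of [|delta| R]. Cauchy theory is
    developed only for circles about 0, read in the coordinate [s] with [z = cexp s]: a circle
    becomes a vertical segment, and Goursat for rectangles is enough. *)

Lemma Cmod_sub_sym (z w : C) : Cmod (z - w) = Cmod (w - z).
Proof. rewrite <- Cmod_opp. f_equal. ring. Qed.

Lemma Cmod_triangle_rev (z w : C) : Cmod z - Cmod w <= Cmod (z - w).
Proof.
  assert (H := Cmod_triangle (z - w) w).
  replace (z - w + w)%C with z in H by ring. lra.
Qed.

Lemma Cmod_sub_triangle (z w : C) : Cmod (z - w) <= Cmod z + Cmod w.
Proof. unfold Cminus. rewrite <- (Cmod_opp w). apply Cmod_triangle. Qed.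

Lemma Cmod_le_abs (z : C) : Cmod z <= Rabs (fst z) + Rabs (snd z).
Proof.
  unfold Cmod.
  rewrite <- (sqrt_Rsqr (Rabs (fst z) + Rabs (snd z)))
    by (apply Rplus_le_le_0_compat; apply Rabs_pos).
  apply sqrt_le_1_alt. unfold Rsqr.
  rewrite <- (pow2_abs (fst z)), <- (pow2_abs (snd z)).
  assert (H1 := Rabs_pos (fst z)). assert (H2 := Rabs_pos (snd z)). nra.
Qed.

Lemma abs_fst_le (z : C) : Rabs (fst z) <= Cmod z.
Proof. apply Rle_trans with (2 := Rmax_Cmod z). apply Rmax_l. Qed.

Lemma abs_snd_le (z : C) : Rabs (snd z) <= Cmod z.
Proof. apply Rle_trans with (2 := Rmax_Cmod z). apply Rmax_r. Qed.

Lemma Cmod_sqr (z : C) : Cmod z * Cmod z = fst z * fst z + snd z * snd z.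
Proof. unfold Cmod. rewrite sqrt_sqrt; nra. Qed.

Lemma Cmod_RtoC_pos (x : R) : 0 <= x -> Cmod (RtoC x) = x.
Proof. intros Hx. rewrite Cmod_R. now apply Rabs_pos_eq. Qed.

Definition cexp (z : C) : C := (exp (fst z) * cos (snd z), exp (fst z) * sin (snd z)).

Lemma cexp_plus (z w : C) : cexp (z + w) = (cexp z * cexp w)%C.
Proof.
  unfold cexp, Cmult, Cplus; simpl. rewrite exp_plus, cos_plus, sin_plus.
  f_equal; ring.
Qed.

Lemma cexp_0 : cexp 0 = 1%C.
Proof. unfold cexp; simpl. rewrite exp_0, cos_0, sin_0. unfold RtoC. f_equal; ring. Qed.

Lemma Cmod_cexp (z : C) : Cmod (cexp z) = exp (fst z).
Proof.
  assert (H := exp_pos (fst z)).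
  apply Rsqr_inj; [apply Cmod_ge_0 | lra |].
  unfold Rsqr. rewrite Cmod_sqr. unfold cexp; simpl.
  assert (E := sin2_cos2 (snd z)). unfold Rsqr in E. nra.
Qed.

Lemma cexp_neq_0 (z : C) : cexp z <> 0%C.
Proof. apply Cmod_gt_0. rewrite Cmod_cexp. apply exp_pos. Qed.

Lemma cexp_opp (z : C) : (cexp z * cexp (- z))%C = 1%C.
Proof. rewrite <- cexp_plus. replace (z + - z)%C with (RtoC 0) by ring. apply cexp_0. Qed.

Lemma exp_quadratic_upper (x : R) : Rabs x <= 1 -> exp x <= 1 + x + x * x.
Proof.
  intros Hx. apply Rabs_le_between in Hx.
  (* [t -> (1 + t + t^2) exp (-t)] has derivative [t (1 - t) exp (-t)]. *)
  set (h := fun t => (1 + t + t * t) * exp (- t)).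
  assert (Hd : forall t, is_derive h t (t * (1 - t) * exp (- t))).
  { intros t. unfold h. auto_derive; [trivial | ring]. }
  assert (K : 1 <= h x).
  { assert (E0 : h 0 = 1) by (unfold h; rewrite Ropp_0, exp_0; ring).
    destruct (MVT_gen h 0 x (fun t => t * (1 - t) * exp (- t))) as [t [Ht Et]].
    - intros t _. apply Hd.
    - intros t _. apply derivable_continuous_pt, ex_derive_Reals_0.
      eexists; apply Hd.
    - assert (P := exp_pos (- t)). unfold Rmin, Rmax in Ht.
      assert (0 <= t * (1 - t) * exp (- t) * (x - 0)); [|lra].
      replace (t * (1 - t) * exp (- t) * (x - 0))
        with ((t * x) * (1 - t) * exp (- t)) by ring.
      destruct (Rle_dec 0 x); apply Rmult_le_pos; try lra;
        apply Rmult_le_pos; nra. }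
  unfold h in K. assert (P := exp_pos x).
  assert (E : exp (- x) * exp x = 1) by (rewrite <- exp_plus, Rplus_opp_l; apply exp_0).
  apply Rmult_le_compat_r with (r := exp x) in K; [|lra].
  rewrite Rmult_assoc, E in K. lra.
Qed.

Lemma exp_ge_linear (x : R) : 1 + x <= exp x.
Proof. destruct (Req_dec x 0) as [->|H]; [rewrite exp_0; lra | left; now apply exp_ineq1]. Qed.

Lemma sin_abs_le (y : R) : Rabs (sin y) <= Rabs y.
Proof.
  destruct (MVT_gen sin 0 y cos) as [t [_ E]].
  - intros t _. auto_derive; [trivial | ring].
  - intros t _. apply continuity_sin.
  - rewrite sin_0, !Rminus_0_r in E. rewrite E, Rabs_mult.
    assert (Rabs (cos t) <= 1) by (apply Rabs_le; destruct (COS_bound t); lra).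
    assert (H1 := Rabs_pos y). nra.
Qed.

Lemma cos_quadratic (y : R) : Rabs (cos y - 1) <= y * y / 2.
Proof.
  replace (cos y) with (1 - 2 * (sin (y / 2) * sin (y / 2)))
    by (replace y with (2 * (y / 2)) at 3 by field; rewrite cos_2a_sin; ring).
  assert (H := sin_abs_le (y / 2)). apply Rsqr_le_abs_1 in H. unfold Rsqr in H.
  rewrite Rabs_left1; nra.
Qed.

Lemma sin_quadratic (y : R) : Rabs (sin y - y) <= y * y / 2 * Rabs y.
Proof.
  destruct (MVT_gen (fun t => sin t - t) 0 y (fun t => cos t - 1)) as [t [Ht E]].
  - intros t _. auto_derive; [trivial | ring].
  - intros t _. apply derivable_continuous_pt, ex_derive_Reals_0.
    auto_derive; trivial.
  - rewrite sin_0, !Rminus_0_r in E. rewrite E, Rabs_mult.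
    apply Rmult_le_compat_r; [apply Rabs_pos|].
    apply Rle_trans with (1 := cos_quadratic t).
    unfold Rmin, Rmax in Ht. destruct (Rle_dec 0 y); nra.
Qed.

(** Source of both the derivative of [cexp] and the near-affinity of [f] on the expanding discs. It
    is reduced to real estimates on [exp], [cos] and [sin], one coordinate at a time. *)
Lemma cexp_quadratic (h : C) : Cmod h <= 1 ->
  Cmod (cexp h - 1 - h) <= 4 * (Cmod h * Cmod h).
Proof.
  intros Hh. rewrite Cmod_sqr.
  assert (Hx := abs_fst_le h). assert (Hy := abs_snd_le h).
  destruct h as [x y]; simpl in *.
  assert (Hx1 : Rabs x <= 1) by lra. assert (Hy1 : Rabs y <= 1) by lra.
  apply Rle_trans with (1 := Cmod_le_abs _). unfold cexp; simpl.
  assert (U := exp_quadratic_upper x Hx1). assert (L := exp_ge_linear x).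
  assert (C1 := cos_quadratic y). assert (S1 := sin_quadratic y).
  assert (P := exp_pos x).
  assert (Ax := Rabs_pos x). assert (Ay := Rabs_pos y).
  assert (Ex : x * x = Rabs x * Rabs x) by (rewrite <- Rabs_mult, Rabs_pos_eq; nra).
  assert (Ey : y * y = Rabs y * Rabs y) by (rewrite <- Rabs_mult, Rabs_pos_eq; nra).
  assert (E3 : exp x <= 3) by (apply Rabs_le_between in Hx1; nra).
  assert (B1 : Rabs (exp x * cos y + - (1) + - x) <= x * x + 3 * (y * y / 2)).
  { replace (exp x * cos y + - (1) + - x) with ((exp x - 1 - x) + exp x * (cos y - 1)) by ring.
    apply Rle_trans with (1 := Rabs_triang _ _).
    apply Rplus_le_compat; [rewrite Rabs_pos_eq; lra |].
    rewrite Rabs_mult, (Rabs_pos_eq (exp x)) by lra.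
    apply Rmult_le_compat; try lra. apply Rabs_pos. }
  assert (B2 : Rabs (exp x * sin y + - 0 + - y) <= 3 * (y * y / 2 * Rabs y) + 2 * Rabs x * Rabs y).
  { replace (exp x * sin y + - 0 + - y) with (exp x * (sin y - y) + (exp x - 1) * y) by ring.
    apply Rle_trans with (1 := Rabs_triang _ _).
    rewrite !Rabs_mult, (Rabs_pos_eq (exp x)) by lra.
    apply Rplus_le_compat; (apply Rmult_le_compat; try lra; try apply Rabs_pos).
    apply Rabs_le. unfold Rabs in *. destruct (Rcase_abs x); nra. }
  apply Rle_trans with (1 := Rplus_le_compat _ _ _ _ B1 B2).
  rewrite Ex, Ey.
  assert (0 <= Rabs y * Rabs y * (1 - Rabs y)) by (apply Rmult_le_pos; nra).
  nra.
Qed.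

(** A principal logarithm, built from [acos] with the sign of the imaginary part. The bound [PI] on
    the argument decides how large a disc around [a] must be controlled. *)
Lemma polar_form (w : C) : w <> 0%C ->
  exists s : C, cexp s = w /\ fst s = ln (Cmod w) /\ Rabs (snd s) <= PI.
Proof.
  intros Hw. apply Cmod_gt_0 in Hw.
  assert (Q := Cmod_sqr w).
  destruct w as [x y]; simpl in *. set (m := Cmod (x, y)) in *.
  assert (B : -1 <= x / m <= 1).
  { assert (A := abs_fst_le (x, y)). simpl in A. fold m in A. apply Rabs_le_between in A.
    split; [apply Rmult_le_reg_r with m | apply Rmult_le_reg_r with m]; try lra;
      unfold Rdiv; rewrite Rmult_assoc, Rinv_l; lra. }
  assert (Ba := acos_bound (x / m)).
  assert (S : sin (acos (x / m)) * m = Rabs y).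
  { rewrite sin_acos by assumption.
    apply Rsqr_inj; [apply Rmult_le_pos; [apply sqrt_pos | lra] | apply Rabs_pos |].
    rewrite <- Rsqr_abs, Rsqr_mult, Rsqr_sqrt by (unfold Rsqr; nra).
    unfold Rsqr. field_simplify; [|lra]. nra. }
  assert (Cx : cos (acos (x / m)) * m = x) by (rewrite cos_acos by assumption; field; lra).
  destruct (Rle_dec 0 y) as [Hy|Hy].
  - exists (ln m, acos (x / m)). unfold cexp; simpl. rewrite exp_ln by lra.
    rewrite (Rabs_pos_eq y) in S by lra.
    split; [f_equal; lra | split; [reflexivity | rewrite Rabs_pos_eq; lra]].
  - exists (ln m, - acos (x / m)). unfold cexp; simpl. rewrite exp_ln, cos_neg, sin_neg by lra.
    rewrite (Rabs_left y) in S by lra.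
    split; [f_equal; lra | split; [reflexivity | rewrite Rabs_Ropp, Rabs_pos_eq; lra]].
Qed.

(* Epsilon-delta notions with [Cmod]: Coquelicot puts two normed-module
   structures on [C], and derivatives in one are not syntactically derivatives
   in the other. *)
Definition ccont (f : C -> C) (z : C) : Prop :=
  forall eps, 0 < eps -> exists del, 0 < del /\
    forall w, Cmod (w - z) < del -> Cmod (f w - f z) < eps.

Definition cdiff (f : C -> C) (z : C) : Prop :=
  exists l : C, forall eps, 0 < eps -> exists del, 0 < del /\
    forall w, Cmod (w - z) < del -> Cmod (f w - f z - l * (w - z)) <= eps * Cmod (w - z).

Lemma cdiff_of_ex_derive (f : C -> C) (z : C) :
  @ex_derive C_AbsRing C_NormedModule f z -> cdiff f z.
Proof.
  intros [l Hl]. exists l. intros eps Heps.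
  destruct Hl as [_ Hl].
  assert (Hz : is_filter_lim (@locally (AbsRing_UniformSpace C_AbsRing) z) z) by (intros P HP; exact HP).
  destruct (Hl z Hz (mkposreal eps Heps)) as [del Hdel].
  exists del. split; [apply cond_pos|]. intros w Hw.
  assert (K := Hdel w Hw). simpl in K.
  change (Cmod (f w - f z - (w - z) * l) <= eps * Cmod (w - z)) in K.
  now rewrite (Cmult_comm l).
Qed.

(** The chain, product and sum rules are imported through this equivalence, which concerns the
    structure [AbsRing_NormedModule C_AbsRing], whereas [entire] is stated with [C_NormedModule]. *)
Lemma cdiff_iff_ex_derive (f : C -> C) (z : C) :
  cdiff f z <-> @ex_derive C_AbsRing (AbsRing_NormedModule C_AbsRing) f z.
Proof.
  split.
  2: { intros [l [_ Hl]]. exists l. intros eps Heps.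
    assert (Hz : is_filter_lim (@locally (AbsRing_UniformSpace C_AbsRing) z) z)
      by (intros P HP; exact HP).
    destruct (Hl z Hz (mkposreal eps Heps)) as [del Hdel].
    exists del. split; [apply cond_pos|]. intros w Hw.
    assert (K := Hdel w Hw).
    change (Cmod (f w - f z - (w - z) * l) <= eps * Cmod (w - z)) in K.
    now rewrite (Cmult_comm l). }
  intros [l Hl]. exists l. split; [apply is_linear_scal_l|].
  intros x Hx eps.
  assert (E : z = x) by (apply (@is_filter_lim_locally_unique _ (AbsRing_NormedModule C_AbsRing)), Hx).
  subst x.
  destruct (Hl eps (cond_pos eps)) as [del [Hdel H]].
  exists (mkposreal del Hdel). intros w Hw.
  assert (K := H w Hw).
  change (Cmod (f w - f z - (w - z) * l) <= eps * Cmod (w - z)).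
  now rewrite (Cmult_comm _ l).
Qed.

Lemma cdiff_ext (f g : C -> C) (z : C) :
  (forall w, f w = g w) -> cdiff f z -> cdiff g z.
Proof.
  intros E [l Hl]. exists l. intros eps Heps. destruct (Hl eps Heps) as [d [Hd H]].
  exists d. split; [assumption|]. intros w. rewrite <- !E. apply H.
Qed.

Lemma cdiff_comp (f g : C -> C) (z : C) :
  cdiff f (g z) -> cdiff g z -> cdiff (fun w => f (g w)) z.
Proof.
  rewrite !cdiff_iff_ex_derive. intros [df Hf] [dg Hg].
  eexists. apply (@is_derive_comp C_AbsRing (AbsRing_NormedModule C_AbsRing) f g z df dg Hf Hg).
Qed.

Lemma cdiff_mult (f g : C -> C) (z : C) :
  cdiff f z -> cdiff g z -> cdiff (fun w => f w * g w)%C z.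
Proof.
  rewrite !cdiff_iff_ex_derive. intros [df Hf] [dg Hg].
  eexists. apply (@is_derive_mult C_AbsRing f g z df dg Hf Hg Cmult_comm).
Qed.

Lemma cdiff_plus (f g : C -> C) (z : C) :
  cdiff f z -> cdiff g z -> cdiff (fun w => f w + g w)%C z.
Proof.
  rewrite !cdiff_iff_ex_derive. intros [df Hf] [dg Hg].
  eexists. apply (@is_derive_plus C_AbsRing (AbsRing_NormedModule C_AbsRing) f g z df dg Hf Hg).
Qed.

Lemma cdiff_affine (a b z : C) : cdiff (fun w => a + b * w)%C z.
Proof.
  exists b. intros eps Heps. exists 1. split; [lra|]. intros w _.
  replace (a + b * w - (a + b * z) - b * (w - z))%C with (RtoC 0) by ring.
  rewrite Cmod_0. apply Rmult_le_pos; [lra | apply Cmod_ge_0].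
Qed.

Lemma cdiff_const (a z : C) : cdiff (fun _ => a) z.
Proof. apply cdiff_ext with (2 := cdiff_affine a 0 z). intros w. ring. Qed.

Lemma cdiff_id (z : C) : cdiff (fun w => w) z.
Proof. apply cdiff_ext with (2 := cdiff_affine 0 1 z). intros w. ring. Qed.

Lemma cdiff_cexp (z : C) : cdiff cexp z.
Proof.
  exists (cexp z). intros eps Heps.
  assert (P := exp_pos (fst z)).
  assert (Q : 0 < eps / (4 * exp (fst z))) by (apply Rdiv_lt_0_compat; lra).
  exists (Rmin 1 (eps / (4 * exp (fst z)))). split; [apply Rmin_glb_lt; lra|].
  intros w Hw.
  assert (H1 := Rlt_le_trans _ _ _ Hw (Rmin_l _ _)).
  assert (H2 := Rlt_le_trans _ _ _ Hw (Rmin_r _ _)).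
  assert (E : cexp w = (cexp z * cexp (w - z))%C) by (rewrite <- cexp_plus; f_equal; ring).
  rewrite E.
  replace (cexp z * cexp (w - z) - cexp z - cexp z * (w - z))%C
    with (cexp z * (cexp (w - z) - 1 - (w - z)))%C by ring.
  rewrite Cmod_mult, Cmod_cexp.
  assert (K := cexp_quadratic (w - z) (Rlt_le _ _ H1)).
  apply Rle_trans with (exp (fst z) * (4 * (Cmod (w - z) * Cmod (w - z)))).
  - apply Rmult_le_compat_l; lra.
  - assert (M := Cmod_ge_0 (w - z)).
    replace (exp (fst z) * (4 * (Cmod (w - z) * Cmod (w - z))))
      with (4 * exp (fst z) * Cmod (w - z) * Cmod (w - z)) by ring.
    apply Rmult_le_compat_r; [assumption|].
    apply Rmult_lt_compat_l with (r := 4 * exp (fst z)) in H2; [|lra].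
    replace (4 * exp (fst z) * (eps / (4 * exp (fst z)))) with eps in H2 by (field; lra).
    lra.
Qed.

Lemma cdiff_inv (z : C) : z <> 0%C -> cdiff Cinv z.
Proof.
  intros Hz. assert (P := proj1 (Cmod_gt_0 z) Hz). set (m := Cmod z) in *.
  exists (- (/ z * / z))%C. intros eps Heps.
  exists (Rmin (m / 2) (eps * (m * m * m) / 2)).
  assert (P3 : 0 < m * m * m) by (repeat apply Rmult_lt_0_compat; lra).
  assert (Pe : 0 < eps * (m * m * m) / 2) by (assert (Q := Rmult_lt_0_compat _ _ Heps P3); lra).
  split; [apply Rmin_glb_lt; lra|].
  intros w Hw.
  assert (H1 := Rlt_le_trans _ _ _ Hw (Rmin_l _ _)).
  assert (H2 := Rlt_le_trans _ _ _ Hw (Rmin_r _ _)).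
  assert (Mw : m / 2 < Cmod w).
  { assert (T := Cmod_triangle_rev z w). fold m in T. rewrite Cmod_sub_sym in T. lra. }
  assert (Hw0 : w <> 0%C) by (apply Cmod_gt_0; lra).
  replace (/ w - / z - - (/ z * / z) * (w - z))%C
    with ((w - z) * (w - z) * / (w * (z * z)))%C by (field; auto).
  assert (w * (z * z) <> 0)%C by (repeat apply Cmult_neq_0; assumption).
  rewrite !Cmod_mult, Cmod_inv, !Cmod_mult by assumption. fold m.
  set (h := Cmod (w - z)) in *. assert (0 <= h) by apply Cmod_ge_0.
  apply Rmult_le_reg_r with (Cmod w * (m * m)); [apply Rmult_lt_0_compat; nra|].
  rewrite Rmult_assoc, Rinv_l by (apply Rgt_not_eq, Rmult_lt_0_compat; nra).
  rewrite Rmult_1_r.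
  replace (eps * h * (Cmod w * (m * m))) with (h * (eps * (m * m) * Cmod w)) by ring.
  apply Rmult_le_compat_l; [assumption|].
  apply Rle_trans with (1 := Rlt_le _ _ H2).
  replace (eps * (m * m * m) / 2) with (eps * (m * m) * (m / 2)) by field.
  apply Rmult_le_compat_l; [|lra]. apply Rmult_le_pos; nra.
Qed.

Lemma cdiff_pow (f : C -> C) (k : nat) (z : C) : cdiff f z -> cdiff (fun w => f w ^ k)%C z.
Proof.
  intros Hf. induction k as [|k IH]; simpl.
  - apply cdiff_const.
  - now apply cdiff_mult.
Qed.

Lemma ccont_of_cdiff (f : C -> C) (z : C) : cdiff f z -> ccont f z.
Proof.
  intros [l Hl] eps Heps. destruct (Hl 1 Rlt_0_1) as [d [Hd H]].
  assert (Q := Cmod_ge_0 l).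
  assert (P : 0 < eps / (Cmod l + 2)) by (apply Rdiv_lt_0_compat; lra).
  exists (Rmin d (eps / (Cmod l + 2))). split; [now apply Rmin_glb_lt|].
  intros w Hw.
  assert (H1 := Rlt_le_trans _ _ _ Hw (Rmin_l _ _)).
  assert (H2 := Rlt_le_trans _ _ _ Hw (Rmin_r _ _)).
  assert (K := H w H1).
  replace (f w - f z)%C with ((f w - f z - l * (w - z)) + l * (w - z))%C by ring.
  apply Rle_lt_trans with (1 := Cmod_triangle _ _). rewrite Cmod_mult.
  apply Rmult_lt_compat_r with (r := Cmod l + 2) in H2; [|lra].
  unfold Rdiv in H2. rewrite Rmult_assoc, Rinv_l in H2 by lra.
  assert (Q2 := Cmod_ge_0 (w - z)). nra.
Qed.

Lemma ccont_comp (f g : C -> C) (z : C) :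
  ccont f (g z) -> ccont g z -> ccont (fun w => f (g w)) z.
Proof.
  intros Hf Hg eps Heps. destruct (Hf eps Heps) as [d [Hd H]].
  destruct (Hg d Hd) as [e [He H']]. exists e. split; [assumption|]. intros w Hw.
  now apply H, H'.
Qed.

Lemma ccont_mult (f g : C -> C) (z : C) :
  ccont f z -> ccont g z -> ccont (fun w => f w * g w)%C z.
Proof.
  intros Hf Hg eps Heps.
  assert (Q := Cmod_ge_0 (f z)). assert (Q' := Cmod_ge_0 (g z)).
  set (A := Cmod (f z) + Cmod (g z) + 1).
  assert (P : 0 < Rmin 1 (eps / (2 * A))).
  { apply Rmin_glb_lt; [lra|]. apply Rdiv_lt_0_compat; unfold A; lra. }
  destruct (Hf _ P) as [d [Hd H]]. destruct (Hg _ P) as [e [He H']].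
  exists (Rmin d e). split; [now apply Rmin_glb_lt|]. intros w Hw.
  assert (H1 := H w (Rlt_le_trans _ _ _ Hw (Rmin_l _ _))).
  assert (H2 := H' w (Rlt_le_trans _ _ _ Hw (Rmin_r _ _))).
  assert (B1 := Rlt_le_trans _ _ _ H1 (Rmin_l _ _)).
  assert (B2 := Rlt_le_trans _ _ _ H1 (Rmin_r _ _)).
  assert (B3 := Rlt_le_trans _ _ _ H2 (Rmin_r _ _)).
  replace (f w * g w - f z * g z)%C
    with ((f w - f z) * (g w - g z) + ((f w - f z) * g z + f z * (g w - g z)))%C by ring.
  apply Rle_lt_trans with (1 := Cmod_triangle _ _).
  apply Rle_lt_trans with (1 := Rplus_le_compat_l _ _ _ (Cmod_triangle _ _)).
  rewrite !Cmod_mult.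
  set (x := Cmod (f w - f z)) in *. set (y := Cmod (g w - g z)) in *.
  assert (0 <= x) by apply Cmod_ge_0. assert (0 <= y) by apply Cmod_ge_0.
  set (t := eps / (2 * A)) in *.
  assert (Et : t * (2 * A) = eps) by (unfold t; field; unfold A; lra).
  assert (x * y <= t) by nra.
  assert (x * Cmod (g z) <= t * Cmod (g z)) by (apply Rmult_le_compat_r; lra).
  assert (Cmod (f z) * y <= Cmod (f z) * t) by (apply Rmult_le_compat_l; lra).
  unfold A in Et. nra.
Qed.

Lemma ccont_coordinates (f : C -> C) (z : C) (eps : R) : ccont f z -> 0 < eps ->
  exists del, 0 < del /\ forall w, Cmod (w - z) < del ->
    Rabs (fst (f w) - fst (f z)) < eps /\ Rabs (snd (f w) - snd (f z)) < eps.
Proof.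
  intros Hf Heps. destruct (Hf eps Heps) as [d [Hd H]]. exists d. split; [assumption|].
  intros w Hw. specialize (H w Hw).
  assert (A := abs_fst_le (f w - f z)). assert (B := abs_snd_le (f w - f z)).
  unfold Cminus, Cplus, Copp in A, B; simpl in A, B. 
  unfold Rminus. split; eapply Rle_lt_trans; eauto.
Qed.

Lemma ccont_continuity_2d (f : C -> C) (x y : R) : ccont f (x, y) ->
  continuity_2d_pt (fun u v => fst (f (u, v))) x y /\
  continuity_2d_pt (fun u v => snd (f (u, v))) x y.
Proof.
  intros Hf. split; intros eps; destruct (ccont_coordinates f _ eps Hf (cond_pos eps)) as [d [Hd H]];
  (assert (Hd2 : 0 < d / 2) by lra); exists (mkposreal _ Hd2); simpl; intros u v Hu Hv;
  apply H; apply Rle_lt_trans with (1 := Cmod_le_abs _); unfold Cminus, Cplus, Copp; simpl;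
  unfold Rminus in *; lra.
Qed.

Lemma ccont_continuous_line (f : C -> C) (z d : C) (t : R) : ccont f (z + RtoC t * d) ->
  continuous (fun s => fst (f (z + RtoC s * d)%C)) t /\
  continuous (fun s => snd (f (z + RtoC s * d)%C)) t.
Proof.
  intros Hf.
  assert (Hd : 0 < Cmod d + 1) by (assert (Q := Cmod_ge_0 d); lra).
  split; apply continuity_pt_filterlim; intros eps Heps;
  destruct (ccont_coordinates f _ eps Hf Heps) as [e [He H]];
  (exists (e / (Cmod d + 1)); split; [now apply Rdiv_lt_0_compat|]);
  intros s [_ Hs]; simpl in *; unfold Rdist in *; apply H;
  replace (z + RtoC s * d - (z + RtoC t * d))%C with (RtoC (s - t) * d)%C
    by (rewrite RtoC_minus; ring);
  rewrite Cmod_mult, Cmod_R;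
  apply Rmult_lt_compat_r with (r := Cmod d + 1) in Hs; try lra;
  unfold Rdiv in Hs; rewrite Rmult_assoc, Rinv_l in Hs by lra;
  assert (Q := Rabs_pos (s - t)); nra.
Qed.

Lemma ccont_uniform (f : C -> C) (a b c d eps : R) : (forall z, ccont f z) -> 0 < eps ->
  exists del, 0 < del /\ forall z w : C,
    a <= fst z <= b -> c <= snd z <= d -> a <= fst w <= b -> c <= snd w <= d ->
    Cmod (w - z) < del -> Cmod (f w - f z) < eps.
Proof.
  intros Hf Heps.
  assert (He : 0 < eps / 2) by lra.
  destruct (uniform_continuity_2d (fun u v => fst (f (u, v))) a b c d
    (fun x y _ _ => proj1 (ccont_continuity_2d f x y (Hf _))) (mkposreal _ He)) as [d1 H1].
  destruct (uniform_continuity_2d (fun u v => snd (f (u, v))) a b c d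
    (fun x y _ _ => proj2 (ccont_continuity_2d f x y (Hf _))) (mkposreal _ He)) as [d2 H2].
  exists (Rmin d1 d2). split; [apply Rmin_glb_lt; apply cond_pos|].
  intros [x y] [u v]; simpl. intros Hx Hy Hu Hv Hw.
  assert (K1 := abs_fst_le ((u, v) - (x, y))). assert (K2 := abs_snd_le ((u, v) - (x, y))).
  unfold Cminus, Cplus, Copp in K1, K2 |- *; simpl in K1, K2.
  assert (M1 := Rmin_l d1 d2). assert (M2 := Rmin_r d1 d2).
  unfold Cminus, Cplus, Copp in Hw; simpl in Hw.
  apply Rle_lt_trans with (1 := Cmod_le_abs _); simpl.
  specialize (H1 x y u v Hx Hy Hu Hv). specialize (H2 x y u v Hx Hy Hu Hv). simpl in *.
  unfold Rminus in *.
  assert (Z1 := H1 ltac:(lra) ltac:(lra)). assert (Z2 := H2 ltac:(lra) ltac:(lra)). lra.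
Qed.

(** By uniform continuity on a square, the segment from 0 to [z] can be walked in a fixed number [n]
    of steps, each changing [f] by less than 1. *)
Lemma ccont_bounded (f : C -> C) (r : R) : (forall z, ccont f z) ->
  exists M, forall z, Cmod z <= r -> Cmod (f z) <= M.
Proof.
  intros Hf.
  destruct (Rle_dec 0 r) as [Hr|Hr].
  2: { exists 0. intros z Hz. assert (Q := Cmod_ge_0 z). lra. }
  destruct (ccont_uniform f (- r) r (- r) r 1 Hf Rlt_0_1) as [d [Hd H]].
  destruct (archimed_cor1 (d / (r + 1))) as [n [Hn Hn0]]; [apply Rdiv_lt_0_compat; lra|].
  assert (Pn : 0 < INR n) by (apply lt_0_INR; lia).
  exists (Cmod (f 0) + INR n). intros z Hz.
  assert (K : forall k, (k <= n)%nat ->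
    Cmod (f (RtoC (INR k / INR n) * z)%C) <= Cmod (f 0) + INR k).
  { induction k as [|k IH]; intros Hk.
    - simpl (INR 0). replace (0 / INR n) with 0 by (field; lra). rewrite Cmult_0_l. lra.
    - assert (B : forall j, (j <= n)%nat ->
        - r <= fst (RtoC (INR j / INR n) * z)%C <= r /\
        - r <= snd (RtoC (INR j / INR n) * z)%C <= r).
      { intros j Hj.
        assert (Bz : Cmod (RtoC (INR j / INR n) * z) <= r).
        { assert (J : 0 <= INR j / INR n <= 1).
          { split; [apply Rdiv_le_0_compat; [apply pos_INR | assumption]|].
            apply Rmult_le_reg_r with (INR n); [assumption|].
            unfold Rdiv. rewrite Rmult_assoc, Rinv_l by lra. apply le_INR in Hj. lra. }
          rewrite Cmod_mult, Cmod_RtoC_pos by lra. assert (Q := Cmod_ge_0 z). nra. }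
        assert (A1 := abs_fst_le (RtoC (INR j / INR n) * z)).
        assert (A2 := abs_snd_le (RtoC (INR j / INR n) * z)).
        split; apply Rabs_le_between; lra. }
      assert (Hstep : Cmod (f (RtoC (INR (S k) / INR n) * z)%C - f (RtoC (INR k / INR n) * z)%C) < 1).
      { apply H; try apply B; try lia.
        replace (RtoC (INR (S k) / INR n) * z - RtoC (INR k / INR n) * z)%C with (RtoC (/ INR n) * z)%C.
        - assert (0 < / INR n) by now apply Rinv_0_lt_compat.
          rewrite Cmod_mult, Cmod_RtoC_pos by lra.
          apply Rle_lt_trans with (/ INR n * (r + 1)).
          + apply Rmult_le_compat_l; lra.
          + apply Rmult_lt_compat_r with (r := r + 1) in Hn; [|lra].
            unfold Rdiv in Hn. rewrite (Rmult_assoc d), Rinv_l in Hn by lra. lra.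
        - rewrite S_INR.
          replace ((INR k + 1) / INR n) with (INR k / INR n + / INR n) by (field; lra).
          rewrite RtoC_plus. ring. }
      assert (T := Cmod_triangle_rev (f (RtoC (INR (S k) / INR n) * z)%C) (f (RtoC (INR k / INR n) * z)%C)).
      rewrite S_INR at 2. specialize (IH ltac:(lia)). lra. }
  specialize (K n (le_n _)). unfold Rdiv in K. rewrite Rinv_r, Cmult_1_l in K by lra. exact K.
Qed.

(** * Integrals of complex-valued functions *)

(* Coquelicot states equations of reals in the carrier of a normed module, where [ring] fails. *)
Ltac as_real_eq := match goal with |- ?x = ?y => change (@eq R x y) end.

Definition pcont (phi : R -> C) : Prop :=
  forall t, continuous (fun s => fst (phi s)) t /\ continuous (fun s => snd (phi s)) t.

Definition CInt (phi : R -> C) (a b : R) : C :=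
  (RInt (fun t => fst (phi t)) a b, RInt (fun t => snd (phi t)) a b).

Lemma pcont_ex_RInt (phi : R -> C) (a b : R) : pcont phi ->
  ex_RInt (fun t => fst (phi t)) a b /\ ex_RInt (fun t => snd (phi t)) a b.
Proof.
  intros H. split; apply (@ex_RInt_continuous R_CompleteNormedModule); intros t _; apply H.
Qed.

Lemma pcont_line (f : C -> C) (z d : C) : (forall w, ccont f w) ->
  pcont (fun t => f (z + RtoC t * d)%C).
Proof. intros Hf t. apply ccont_continuous_line, Hf. Qed.

Lemma pcont_ext (phi psi : R -> C) : (forall t, phi t = psi t) -> pcont phi -> pcont psi.
Proof.
  intros E H t. split.
  - apply (continuous_ext (fun s => fst (phi s))); [intros s; now rewrite E | apply H].
  - apply (continuous_ext (fun s => snd (phi s))); [intros s; now rewrite E | apply H].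
Qed.

Lemma pcont_const (c : C) : pcont (fun _ => c).
Proof. intros t. split; apply continuous_const. Qed.

Lemma pcont_plus (phi psi : R -> C) : pcont phi -> pcont psi ->
  pcont (fun t => phi t + psi t)%C.
Proof.
  intros H K t. split; simpl.
  - apply (@continuous_plus _ R_AbsRing R_NormedModule); [apply H | apply K].
  - apply (@continuous_plus _ R_AbsRing R_NormedModule); [apply H | apply K].
Qed.

Lemma pcont_mult (phi psi : R -> C) : pcont phi -> pcont psi ->
  pcont (fun t => phi t * psi t)%C.
Proof.
  intros H K t. split; simpl.
  - apply (@continuous_minus _ R_AbsRing R_NormedModule);
      apply (@continuous_mult _ R_AbsRing); try apply H; apply K.
  - apply (@continuous_plus _ R_AbsRing R_NormedModule);
      apply (@continuous_mult _ R_AbsRing); try apply H; apply K.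
Qed.

Lemma pcont_conj (phi : R -> C) : pcont phi -> pcont (fun t => Cconj (phi t)).
Proof.
  intros H t. split; simpl; [apply H|].
  apply (@continuous_opp _ R_AbsRing R_NormedModule), H.
Qed.

Lemma CInt_ext (phi psi : R -> C) (a b : R) : (forall t, phi t = psi t) ->
  CInt phi a b = CInt psi a b.
Proof. intros E. unfold CInt. f_equal; apply RInt_ext; intros t _; now rewrite E. Qed.

Lemma CInt_plus (phi psi : R -> C) (a b : R) : pcont phi -> pcont psi ->
  CInt (fun t => phi t + psi t)%C a b = (CInt phi a b + CInt psi a b)%C.
Proof.
  intros H K.
  destruct (pcont_ex_RInt _ a b H). destruct (pcont_ex_RInt _ a b K).
  unfold CInt, Cplus; simpl. f_equal; now apply (@RInt_plus R_CompleteNormedModule).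
Qed.

Lemma CInt_scal (c : C) (phi : R -> C) (a b : R) : pcont phi ->
  CInt (fun t => c * phi t)%C a b = (c * CInt phi a b)%C.
Proof.
  intros H. destruct (pcont_ex_RInt _ a b H) as [E1 E2].
  assert (S : forall k g, ex_RInt g a b ->
    RInt (fun t => k * g t) a b = k * RInt g a b /\ ex_RInt (fun t => k * g t) a b).
  { intros k g Eg. split.
    - exact (@RInt_scal R_CompleteNormedModule g a b k Eg).
    - exact (@ex_RInt_scal R_NormedModule g a b k Eg). }
  unfold CInt, Cmult; simpl. f_equal.
  - rewrite <- !(proj1 (S _ _ E1)), <- !(proj1 (S _ _ E2)).
    exact (@RInt_minus R_CompleteNormedModule _ _ a b (proj2 (S _ _ E1)) (proj2 (S _ _ E2))).
  - rewrite <- !(proj1 (S _ _ E1)), <- !(proj1 (S _ _ E2)).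
    exact (@RInt_plus R_CompleteNormedModule _ _ a b (proj2 (S _ _ E2)) (proj2 (S _ _ E1))).
Qed.

Lemma CInt_const (c : C) (a b : R) : CInt (fun _ => c) a b = (RtoC (b - a) * c)%C.
Proof.
  unfold CInt. rewrite !(@RInt_const R_CompleteNormedModule).
  unfold Cmult, RtoC; simpl. unfold scal; simpl. unfold mult; simpl. f_equal; ring.
Qed.

Lemma CInt_conj (phi : R -> C) (a b : R) : pcont phi ->
  CInt (fun t => Cconj (phi t)) a b = Cconj (CInt phi a b).
Proof.
  intros H. destruct (pcont_ex_RInt _ a b H) as [_ E].
  unfold CInt, Cconj; simpl. f_equal. now apply (@RInt_opp R_CompleteNormedModule).
Qed.

Lemma CInt_Chasles (phi : R -> C) (a b c : R) : pcont phi ->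
  (CInt phi a b + CInt phi b c)%C = CInt phi a c.
Proof.
  intros H. unfold CInt, Cplus; simpl.
  destruct (pcont_ex_RInt _ a b H). destruct (pcont_ex_RInt _ b c H).
  f_equal; now apply (@RInt_Chasles R_CompleteNormedModule).
Qed.

(** The pair of coordinates is integrated as one function into a real normed module whose norm is
    [Cmod]. The majorant is a function because [coef_re_bound] evaluates its integral exactly. *)
Lemma CInt_norm_le (phi : R -> C) (g : R -> R) (a b : R) : a <= b -> pcont phi ->
  (forall t, continuous g t) -> (forall t, a <= t <= b -> Cmod (phi t) <= g t) ->
  Cmod (CInt phi a b) <= RInt g a b.
Proof.
  intros Hab H Hg Hle. destruct (pcont_ex_RInt _ a b H) as [E1 E2].
  assert (I : @is_RInt C_R_NormedModule phi a b (CInt phi a b)).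
  { apply (@is_RInt_fct_extend_pair R_NormedModule R_NormedModule);
      now apply (@RInt_correct R_CompleteNormedModule). }
  rewrite Cmod_norm.
  assert (Eg : ex_RInt g a b) by (apply (@ex_RInt_continuous R_CompleteNormedModule); auto).
  refine (@norm_RInt_le C_R_NormedModule phi g a b _ _ Hab _ I
    (@RInt_correct R_CompleteNormedModule _ _ _ Eg)).
  intros t Ht. apply Rle_trans with (2 := Hle t Ht). right. symmetry. apply Cmod_norm.
Qed.

Lemma CInt_norm_le_const (phi : R -> C) (M a b : R) : a <= b -> pcont phi ->
  (forall t, a <= t <= b -> Cmod (phi t) <= M) -> Cmod (CInt phi a b) <= (b - a) * M.
Proof.
  intros Hab H Hle.
  replace ((b - a) * M) with (RInt (fun _ => M) a b) by apply (@RInt_const R_CompleteNormedModule).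
  apply CInt_norm_le; auto. intros t. apply continuous_const.
Qed.

Lemma CInt_affine (p q : C) (a b : R) :
  CInt (fun t => p + RtoC t * q)%C a b
  = (RtoC (b - a) * p + RtoC ((b * b - a * a) / 2) * q)%C.
Proof.
  assert (I : forall u v : R, RInt (fun t => u + t * v) a b = (b - a) * u + (b * b - a * a) / 2 * v).
  { intros u v. apply is_RInt_unique.
    replace ((b - a) * u + (b * b - a * a) / 2 * v)
      with (minus (u * b + v * (b * b) / 2) (u * a + v * (a * a) / 2))
      by (unfold minus, plus, opp; simpl; as_real_eq; field).
    apply (@is_RInt_derive R_CompleteNormedModule (fun t => u * t + v * (t * t) / 2)).
    - intros t _. auto_derive; [trivial | field].
    - intros t _. apply (ex_derive_continuous (fun t => u + t * v)). auto_derive; trivial. }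
  unfold CInt, Cplus, Cmult, RtoC; simpl. f_equal.
  - rewrite <- (RInt_ext (fun t => fst p + t * fst q)) by (intros; as_real_eq; ring).
    rewrite I. as_real_eq. ring.
  - rewrite <- (RInt_ext (fun t => snd p + t * snd q)) by (intros; as_real_eq; ring).
    rewrite I. as_real_eq. ring.
Qed.

(* Integral over the counterclockwise boundary of [[a, b] x [c, d]]. *)
Definition bdint (f : C -> C) (a b c d : R) : C :=
  (CInt (fun t => f (t, c)) a b - CInt (fun t => f (t, d)) a b
   + Ci * (CInt (fun t => f (b, t)) c d - CInt (fun t => f (a, t)) c d))%C.

Lemma pcont_horizontal (f : C -> C) (c : R) : (forall w, ccont f w) -> pcont (fun t => f (t, c)).
Proof.
  intros Hf. apply pcont_ext with (2 := pcont_line f (0, c) (1, 0) Hf).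
  intros t. f_equal. unfold Cplus, Cmult, RtoC; simpl. f_equal; ring.
Qed.

Lemma pcont_vertical (f : C -> C) (a : R) : (forall w, ccont f w) -> pcont (fun t => f (a, t)).
Proof.
  intros Hf. apply pcont_ext with (2 := pcont_line f (a, 0) (0, 1) Hf).
  intros t. f_equal. unfold Cplus, Cmult, RtoC; simpl. f_equal; ring.
Qed.

Lemma bdint_split_x (f : C -> C) (a m b c d : R) : (forall w, ccont f w) ->
  bdint f a b c d = (bdint f a m c d + bdint f m b c d)%C.
Proof.
  intros Hf. unfold bdint.
  rewrite <- (CInt_Chasles (fun t => f (t, c)) a m b) by now apply pcont_horizontal.
  rewrite <- (CInt_Chasles (fun t => f (t, d)) a m b) by now apply pcont_horizontal.
  ring.
Qed.

Lemma bdint_split_y (f : C -> C) (a b c m d : R) : (forall w, ccont f w) ->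
  bdint f a b c d = (bdint f a b c m + bdint f a b m d)%C.
Proof.
  intros Hf. unfold bdint.
  rewrite <- (CInt_Chasles (fun t => f (a, t)) c m d) by now apply pcont_vertical.
  rewrite <- (CInt_Chasles (fun t => f (b, t)) c m d) by now apply pcont_vertical.
  ring.
Qed.

(** Explicit integration settles the one case of Cauchy's theorem that Goursat's argument
    presupposes: the first-order Taylor polynomial. *)
Lemma bdint_affine (p q : C) (a b c d : R) : bdint (fun z => p + q * z)%C a b c d = 0%C.
Proof.
  unfold bdint.
  rewrite (CInt_ext (fun t => p + q * (t, c))%C (fun t => (p + (RtoC c * Ci) * q) + RtoC t * q)%C)
    by (intros t; unfold Cplus, Cmult, RtoC, Ci; simpl; f_equal; ring).
  rewrite (CInt_ext (fun t => p + q * (t, d))%C (fun t => (p + (RtoC d * Ci) * q) + RtoC t * q)%C)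
    by (intros t; unfold Cplus, Cmult, RtoC, Ci; simpl; f_equal; ring).
  rewrite (CInt_ext (fun t => p + q * (b, t))%C (fun t => (p + RtoC b * q) + RtoC t * (Ci * q))%C)
    by (intros t; unfold Cplus, Cmult, RtoC, Ci; simpl; f_equal; ring).
  rewrite (CInt_ext (fun t => p + q * (a, t))%C (fun t => (p + RtoC a * q) + RtoC t * (Ci * q))%C)
    by (intros t; unfold Cplus, Cmult, RtoC, Ci; simpl; f_equal; ring).
  rewrite !CInt_affine.
  unfold Cminus, Copp, Cplus, Cmult, RtoC, Ci; simpl. f_equal; field.
Qed.

(** * Goursat's theorem for rectangles *)

Lemma bdint_plus_affine (f : C -> C) (p q : C) (a b c d : R) : (forall w, ccont f w) ->
  bdint (fun z => f z + (p + q * z))%C a b c d = bdint f a b c d.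
Proof.
  intros Hf.
  assert (Hg : forall w, ccont (fun z => p + q * z)%C w)
    by (intros w; apply ccont_of_cdiff, cdiff_affine).
  rewrite <- (Cplus_0_r (bdint f a b c d)), <- (bdint_affine p q a b c d).
  unfold bdint.
  assert (Kh : forall u, CInt (fun t => f (t, u) + (p + q * (t, u)))%C a b
    = (CInt (fun t => f (t, u)) a b + CInt (fun t => p + q * (t, u))%C a b)%C).
  { intros u. apply CInt_plus; [now apply pcont_horizontal|].
    exact (pcont_horizontal (fun z => p + q * z)%C u Hg). }
  assert (Kv : forall u, CInt (fun t => f (u, t) + (p + q * (u, t)))%C c d
    = (CInt (fun t => f (u, t)) c d + CInt (fun t => p + q * (u, t))%C c d)%C).
  { intros u. apply CInt_plus; [now apply pcont_vertical|].
    exact (pcont_vertical (fun z => p + q * z)%C u Hg). }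
  rewrite !Kh, !Kv.
  ring.
Qed.

Lemma ccont_plus_affine (f : C -> C) (p q z : C) : ccont f z ->
  ccont (fun z => f z + (p + q * z))%C z.
Proof.
  intros Hf eps Heps.
  assert (He : 0 < eps / 2) by lra.
  destruct (Hf _ He) as [d1 [Hd1 H1]].
  destruct (ccont_of_cdiff _ z (cdiff_affine p q z) _ He) as [d2 [Hd2 H2]].
  exists (Rmin d1 d2). split; [now apply Rmin_glb_lt|]. intros w Hw.
  assert (K1 := H1 w (Rlt_le_trans _ _ _ Hw (Rmin_l _ _))).
  assert (K2 := H2 w (Rlt_le_trans _ _ _ Hw (Rmin_r _ _))).
  replace (f w + (p + q * w) - (f z + (p + q * z)))%C
    with ((f w - f z) + (p + q * w - (p + q * z)))%C by ring.
  apply Rle_lt_trans with (1 := Cmod_triangle _ _). lra.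
Qed.

Lemma bdint_norm_le (f : C -> C) (M a b c d : R) : (forall w, ccont f w) ->
  a <= b -> c <= d ->
  (forall z, a <= fst z <= b -> c <= snd z <= d -> Cmod (f z) <= M) ->
  Cmod (bdint f a b c d) <= 2 * (b - a + (d - c)) * M.
Proof.
  intros Hf Hab Hcd HM.
  assert (H1 := CInt_norm_le_const _ M a b Hab (pcont_horizontal f c Hf)
    (fun t Ht => HM (t, c) Ht (conj (Rle_refl _) Hcd))).
  assert (H2 := CInt_norm_le_const _ M a b Hab (pcont_horizontal f d Hf)
    (fun t Ht => HM (t, d) Ht (conj Hcd (Rle_refl _)))).
  assert (H3 := CInt_norm_le_const _ M c d Hcd (pcont_vertical f a Hf)
    (fun t Ht => HM (a, t) (conj (Rle_refl _) Hab) Ht)).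
  assert (H4 := CInt_norm_le_const _ M c d Hcd (pcont_vertical f b Hf)
    (fun t Ht => HM (b, t) (conj Hab (Rle_refl _)) Ht)).
  unfold bdint. apply Rle_trans with (1 := Cmod_triangle _ _).
  rewrite Cmod_mult, Cmod_Ci.
  apply Rle_trans with (1 := Rplus_le_compat _ _ _ _ (Cmod_sub_triangle _ _)
    (Rmult_le_compat_l 1 _ _ Rle_0_1 (Cmod_sub_triangle _ _))).
  lra.
Qed.

(** The supremum of the lower ends works. It provides both the limit point in Goursat's theorem and
    the limits of the contraction. *)
Lemma nested_intervals (lo hi : nat -> R) :
  (forall k, lo k <= lo (S k) /\ hi (S k) <= hi k /\ lo k <= hi k) ->
  exists l, forall k, lo k <= l <= hi k.
Proof.
  intros H.
  assert (Hup : forall j k, lo k <= lo (j + k)%nat).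
  { induction j as [|j IH]; intros k; simpl; [lra|].
    apply Rle_trans with (1 := IH k), H. }
  assert (Hdn : forall j k, hi (j + k)%nat <= hi k).
  { induction j as [|j IH]; intros k; simpl; [lra|].
    apply Rle_trans with (2 := IH k), H. }
  assert (Hx : forall j k, lo j <= hi k).
  { intros j k. apply Rle_trans with (lo (k + j)%nat); [apply Hup|].
    apply Rle_trans with (hi (k + j)%nat); [apply H|].
    rewrite Nat.add_comm. apply Hdn. }
  destruct (completeness (fun y => exists k, y = lo k)) as [l [Hl1 Hl2]].
  - exists (hi 0%nat). intros y [k ->]. apply Hx.
  - exists (lo 0%nat). now exists 0%nat.
  - exists l. intros k. split; [apply Hl1; now exists k|].
    apply Hl2. intros y [j ->]. apply Hx.
Qed.

(** The integrals over the four quarters add up to the whole, so one of them carries at least a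
    quarter of its modulus. The quarter is recorded by its lower left corner, so that the bisection
    is a sequence of points. *)
Lemma bdint_quarter (f : C -> C) (a b c d : R) : (forall w, ccont f w) ->
  exists a' c', (a' = a \/ a' = (a + b) / 2) /\ (c' = c \/ c' = (c + d) / 2) /\
    Cmod (bdint f a b c d) / 4
      <= Cmod (bdint f a' (a' + (b - a) / 2) c' (c' + (d - c) / 2)).
Proof.
  intros Hf.
  set (m := (a + b) / 2). set (n := (c + d) / 2).
  assert (E : bdint f a b c d = (bdint f a m c n + bdint f a m n d
    + (bdint f m b c n + bdint f m b n d))%C).
  { rewrite (bdint_split_x f a m b c d Hf), (bdint_split_y f a m c n d Hf),
      (bdint_split_y f m b c n d Hf). reflexivity. }
  assert (T : Cmod (bdint f a b c d) <= Cmod (bdint f a m c n) + Cmod (bdint f a m n d)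
    + (Cmod (bdint f m b c n) + Cmod (bdint f m b n d))).
  { rewrite E. apply Rle_trans with (1 := Cmod_triangle _ _).
    apply Rplus_le_compat; apply Cmod_triangle. }
  assert (Em : a + (b - a) / 2 = m) by (unfold m; field).
  assert (En : c + (d - c) / 2 = n) by (unfold n; field).
  assert (Eb : m + (b - a) / 2 = b) by (unfold m; field).
  assert (Ed : n + (d - c) / 2 = d) by (unfold n; field).
  set (v := Cmod (bdint f a b c d)) in *.
  destruct (Rle_dec (v / 4) (Cmod (bdint f a m c n))).
  { exists a, c. rewrite Em, En. auto. }
  destruct (Rle_dec (v / 4) (Cmod (bdint f a m n d))).
  { exists a, n. rewrite Em, Ed. auto. }
  destruct (Rle_dec (v / 4) (Cmod (bdint f m b c n))).
  { exists m, c. rewrite Eb, En. auto. }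
  exists m, n. rewrite Eb, Ed. split; [auto | split; [auto | lra]].
Qed.

(** Bisection: after [k] steps the integral is still at least [4 ^ -k] of the original, while
    subtracting the tangent at the limit point bounds it by perimeter times [e] times diameter, also
    of order [4 ^ -k]. Continuity on the plane and differentiability on the rectangle are separated
    because later functions may fail to be differentiable on a line. *)
Lemma goursat (f : C -> C) (a c w h : R) : (forall z, ccont f z) -> 0 <= w -> 0 <= h ->
  (forall z, a <= fst z <= a + w -> c <= snd z <= c + h -> cdiff f z) ->
  bdint f a (a + w) c (c + h) = 0%C.
Proof.
  intros Hf Hw Hh Hd.
  set (B := fun k (p : R * R) =>
    Cmod (bdint f (fst p) (fst p + w / 2 ^ k) (snd p) (snd p + h / 2 ^ k))).
  set (good := fun k (p p' : R * R) =>
    (fst p' = fst p \/ fst p' = fst p + w / 2 ^ S k) /\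
    (snd p' = snd p \/ snd p' = snd p + h / 2 ^ S k) /\ B k p / 4 <= B (S k) p').
  assert (P2 : forall k, 0 < 2 ^ k) by (intros k; apply pow_lt; lra).
  assert (Half : forall k u, u / 2 ^ S k = u / 2 ^ k / 2).
  { intros k u. simpl. field. specialize (P2 k). lra. }
  assert (Hnext : forall kp : nat * (R * R), exists p', good (fst kp) (snd kp) p').
  { intros [k [x y]].
    destruct (bdint_quarter f x (x + w / 2 ^ k) y (y + h / 2 ^ k) Hf) as [x' [y' [Hx [Hy Hv]]]].
    exists (x', y'). unfold good, B; simpl fst; simpl snd. rewrite !Half.
    split; [destruct Hx; [auto | right; lra] |].
    split; [destruct Hy; [auto | right; lra] |].
    replace (x + w / 2 ^ k - x) with (w / 2 ^ k) in Hv by ring.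
    replace (y + h / 2 ^ k - y) with (h / 2 ^ k) in Hv by ring. exact Hv. }
  set (next := fun k p => proj1_sig (constructive_indefinite_description _ (Hnext (k, p)))).
  assert (Hgood : forall k p, good k p (next k p))
    by (intros k p; exact (proj2_sig (constructive_indefinite_description _ (Hnext (k, p))))).
  set (s := fix s k := match k with O => (a, c) | S j => next j (s j) end).
  assert (Hs : forall k, good k (s k) (s (S k))) by (intros k; apply Hgood).
  assert (Pw : forall k, 0 <= w / 2 ^ k) by (intros k; now apply Rdiv_le_0_compat).
  assert (Ph : forall k, 0 <= h / 2 ^ k) by (intros k; now apply Rdiv_le_0_compat).
  destruct (nested_intervals (fun k => fst (s k)) (fun k => fst (s k) + w / 2 ^ k)) as [x Hx].
  { intros k. destruct (Hs k) as [[E|E] _]; rewrite E, (Half k w); specialize (Pw k); lra. }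
  destruct (nested_intervals (fun k => snd (s k)) (fun k => snd (s k) + h / 2 ^ k)) as [y Hy].
  { intros k. destruct (Hs k) as [_ [[E|E] _]]; rewrite E, (Half k h); specialize (Ph k); lra. }
  assert (HB : forall k, B 0%nat (s 0%nat) / 4 ^ k <= B k (s k)).
  { induction k as [|k IH]; [simpl; lra|].
    destruct (Hs k) as [_ [_ Hv]]. apply Rle_trans with (2 := Hv).
    replace (B 0%nat (s 0%nat) / 4 ^ S k) with (B 0%nat (s 0%nat) / 4 ^ k / 4)
      by (simpl; field; apply pow_nonzero; lra). lra. }
  assert (E0 : B 0%nat (s 0%nat) = Cmod (bdint f a (a + w) c (c + h)))
    by (unfold B; simpl; now rewrite !Rdiv_1_r).
  rewrite E0 in HB.
  destruct (Hd (x, y)) as [l Hl].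
  { specialize (Hx 0%nat). simpl in Hx. rewrite Rdiv_1_r in Hx. exact Hx. }
  { specialize (Hy 0%nat). simpl in Hy. rewrite Rdiv_1_r in Hy. exact Hy. }
  apply Cmod_eq_0. apply Rle_antisym; [|apply Cmod_ge_0].
  apply le_epsilon. intros eps Heps. rewrite Rplus_0_l.
  (* Chosen so that [2 (w + h) ^ 2 e <= eps]; the added 1 keeps the denominator positive for
     degenerate rectangles. *)
  set (e := eps / (2 * (w + h + 1) * (w + h + 1))).
  assert (He : 0 < e) by (apply Rdiv_lt_0_compat; [assumption | repeat apply Rmult_lt_0_compat; lra]).
  destruct (Hl e He) as [del [Hdel Hl']].
  destruct (Pow_x_infinity 2 ltac:(rewrite Rabs_pos_eq; lra) ((w + h + 1) / del)) as [k Hk].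
  specialize (Hk k (le_n k)). rewrite Rabs_pos_eq in Hk by (left; apply P2).
  assert (Hk2 : (w + h + 1) / 2 ^ k <= del).
  { apply Rmult_le_reg_r with (2 ^ k); [apply P2|].
    unfold Rdiv. rewrite Rmult_assoc, Rinv_l by (apply Rgt_not_eq, P2).
    apply Rge_le, Rmult_le_compat_r with (r := del) in Hk; [|lra].
    unfold Rdiv in Hk. rewrite Rmult_assoc, Rinv_l in Hk by lra. lra. }
  set (W := w / 2 ^ k + h / 2 ^ k).
  assert (HW : W < del).
  { apply Rlt_le_trans with (2 := Hk2). unfold W.
    replace ((w + h + 1) / 2 ^ k) with (w / 2 ^ k + h / 2 ^ k + / 2 ^ k)
      by (field; apply Rgt_not_eq, P2).
    assert (0 < / 2 ^ k) by apply Rinv_0_lt_compat, P2. lra. }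
  assert (W0 : 0 <= W) by (unfold W; specialize (Pw k); specialize (Ph k); lra).
  (* Adding the negative of the tangent at [(x, y)] leaves the integral unchanged and turns the
     integrand into the remainder of differentiability. *)
  assert (Key : B k (s k) <= 2 * W * (e * W)).
  { unfold B.
    rewrite <- (bdint_plus_affine f (l * (x, y) - f (x, y)) (- l) _ _ _ _ Hf).
    replace (2 * W) with (2 * (fst (s k) + w / 2 ^ k - fst (s k)
      + (snd (s k) + h / 2 ^ k - snd (s k)))) by (unfold W; ring).
    apply bdint_norm_le.
    - intros z. now apply ccont_plus_affine.
    - specialize (Pw k). lra.
    - specialize (Ph k). lra.
    - intros z Hz1 Hz2.
      assert (Hz : Cmod (z - (x, y)) <= W).
      { apply Rle_trans with (1 := Cmod_le_abs _). unfold Cminus, Cplus, Copp; simpl.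
        specialize (Hx k). specialize (Hy k). simpl in Hx, Hy.
        apply Rplus_le_compat; apply Rabs_le; lra. }
      specialize (Hl' z ltac:(lra)).
      replace (f z + (l * (x, y) - f (x, y) + - l * z))%C
        with (f z - f (x, y) - l * (z - (x, y)))%C by ring.
      apply Rle_trans with (1 := Hl'). apply Rmult_le_compat_l; lra. }
  specialize (HB k).
  assert (P4 : 0 < 4 ^ k) by (apply pow_lt; lra).
  assert (F := Rle_trans _ _ _ HB Key).
  apply Rmult_le_compat_r with (r := 4 ^ k) in F; [|lra].
  unfold Rdiv at 1 in F. rewrite Rmult_assoc, Rinv_l, Rmult_1_r in F by lra.
  apply Rle_trans with (1 := F).
  assert (E4 : 4 ^ k = 2 ^ k * 2 ^ k) by (rewrite <- Rpow_mult_distr; f_equal; lra).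
  rewrite E4. unfold W. specialize (P2 k).
  replace (2 * (w / 2 ^ k + h / 2 ^ k) * (e * (w / 2 ^ k + h / 2 ^ k)) * (2 ^ k * 2 ^ k))
    with (e * (2 * (w + h) * (w + h))) by (field; lra).
  apply Rle_trans with (e * (2 * (w + h + 1) * (w + h + 1))).
  - apply Rmult_le_compat_l; nra.
  - unfold e. right. field. lra.
Qed.

(** * Integrals over circles in logarithmic coordinates *)

(* For [f = h o cexp] this is the mean of [h] over the circle of radius
   [exp x], times [2 PI]. *)
Definition vint (f : C -> C) (x : R) : C := CInt (fun t => f (x, t)) 0 (2 * PI).

(** Goursat on the rectangle of height [2 * PI]: periodicity makes the horizontal sides cancel, and
    the vertical sides are the two values of [vint]. *)
Lemma vint_strip (f : C -> C) (a b : R) : a <= b -> (forall z, ccont f z) ->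
  (forall t, f (t, 2 * PI) = f (t, 0)) ->
  (forall z, a <= fst z <= b -> cdiff f z) -> vint f a = vint f b.
Proof.
  intros Hab Hf Hp Hd. assert (P := PI_RGT_0).
  assert (G := goursat f a 0 (b - a) (2 * PI) Hf ltac:(lra) ltac:(lra)).
  replace (a + (b - a)) with b in G by ring. rewrite Rplus_0_l in G.
  specialize (G (fun z H _ => Hd z H)).
  unfold bdint in G. rewrite (CInt_ext (fun t => f (t, 2 * PI)) (fun t => f (t, 0)) a b Hp) in G.
  fold (vint f a) in G. fold (vint f b) in G.
  replace (vint f b) with (vint f a + - Ci * (Ci * (vint f b - vint f a)))%C.
  2: { replace (- Ci * (Ci * (vint f b - vint f a)))%C with (- (Ci * Ci) * (vint f b - vint f a))%C by ring.
    replace (- (Ci * Ci))%C with (RtoC 1); [ring|].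
    unfold Ci, Copp, Cmult, RtoC; simpl. f_equal; ring. }
  set (u := CInt (fun t => f (t, 0)) a b) in *. 
  replace (u - u + Ci * (vint f b - vint f a))%C with (Ci * (vint f b - vint f a))%C in G by ring.
  rewrite G. ring.
Qed.

Lemma vint_sub_le (f : C -> C) (x0 eps : R) : (forall z, ccont f z) -> 0 < eps ->
  exists del, 0 < del /\ forall x, Rabs (x - x0) < del -> Cmod (vint f x - vint f x0) <= eps.
Proof.
  intros Hf Heps. assert (P := PI_RGT_0).
  destruct (ccont_uniform f (x0 - 1) (x0 + 1) 0 (2 * PI) (eps / (2 * PI)) Hf) as [d [Hd H]].
  { apply Rdiv_lt_0_compat; lra. }
  exists (Rmin 1 d). split; [apply Rmin_glb_lt; lra|]. intros x Hx.
  assert (H1 := Rlt_le_trans _ _ _ Hx (Rmin_l _ _)).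
  assert (H2 := Rlt_le_trans _ _ _ Hx (Rmin_r _ _)).
  apply Rabs_lt_between in H1.
  replace (vint f x - vint f x0)%C with (CInt (fun t => f (x, t) + - (1) * f (x0, t))%C 0 (2 * PI)).
  - replace eps with ((2 * PI - 0) * (eps / (2 * PI))) by (field; lra).
    apply CInt_norm_le_const; [lra | |].
    + apply pcont_plus; [now apply pcont_vertical|].
      apply pcont_mult; [apply pcont_const | now apply pcont_vertical].
    + intros t Ht. replace (f (x, t) + - (1) * f (x0, t))%C with (f (x, t) - f (x0, t))%C by ring.
      left. apply H; simpl; try lra.
      apply Rle_lt_trans with (1 := Cmod_le_abs _). unfold Cminus, Cplus, Copp; simpl.
      rewrite Rplus_opp_r, Rabs_R0. unfold Rminus in H2. lra.
  - rewrite CInt_plus, CInt_scal;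
      [unfold vint; ring | now apply pcont_vertical | now apply pcont_vertical |].
    apply pcont_mult; [apply pcont_const | now apply pcont_vertical].
Qed.

(* Both half planes bounded by the line [Re z = x0] have constant [vint], and
   continuity glues the two constants; no derivative is needed on the line. *)
Lemma vint_const (f : C -> C) (x0 : R) : (forall z, ccont f z) ->
  (forall t, f (t, 2 * PI) = f (t, 0)) ->
  (forall z, fst z <> x0 -> cdiff f z) -> forall x, vint f x = vint f x0.
Proof.
  intros Hf Hp Hd x.
  destruct (Req_dec x x0) as [->|Hx]; [reflexivity|].
  apply Ceq_minus, Cmod_eq_0, Rle_antisym; [|apply Cmod_ge_0].
  apply le_epsilon. intros eps Heps. rewrite Rplus_0_l.
  destruct (vint_sub_le f x0 eps Hf Heps) as [d [Hdp H]].
  set (s := Rmin (d / 2) (Rabs (x - x0))).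
  assert (Hs : 0 < s) by (apply Rmin_glb_lt; [lra | apply Rabs_pos_lt; lra]).
  assert (S1 := Rmin_l (d / 2) (Rabs (x - x0))). assert (S2 := Rmin_r (d / 2) (Rabs (x - x0))).
  fold s in S1, S2.
  destruct (Rle_dec x x0) as [L|L].
  - rewrite Rabs_left1 in S2 by lra.
    rewrite (vint_strip f x (x0 - s)); try assumption; try lra.
    + apply H. rewrite Rabs_left; lra.
    + intros z Hz. apply Hd. lra.
  - rewrite Rabs_pos_eq in S2 by lra.
    rewrite <- (vint_strip f (x0 + s) x); try assumption; try lra.
    + apply H. rewrite Rabs_pos_eq; lra.
    + intros z Hz. apply Hd. lra.
Qed.

Lemma cexp_period (x : R) : cexp (x, 2 * PI) = cexp (x, 0).
Proof. unfold cexp; simpl. now rewrite cos_2PI, sin_2PI, cos_0, sin_0. Qed.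

(** Up to a factor [Ci] this is the integral of [g dz] over a circle about 0. It does not depend on
    the radius, and it is at most [2 PI B r] on small circles, because [g] is bounded near 0. The
    exceptional circle of radius [exp x0] makes room for one point where only continuity of [g] is
    known. *)
Lemma vint_zero (g : C -> C) (x0 : R) : (forall z, ccont g z) ->
  (forall z : C, z <> 0%C -> Cmod z <> exp x0 -> cdiff g z) ->
  forall x, vint (fun s => g (cexp s) * cexp s)%C x = 0%C.
Proof.
  intros Hg Hd. assert (P := PI_RGT_0).
  set (F := fun s => (g (cexp s) * cexp s)%C).
  assert (Ce : forall s, ccont cexp s) by (intros s; apply ccont_of_cdiff, cdiff_cexp).
  assert (HF : forall z, ccont F z).
  { intros z. apply ccont_mult; [|apply Ce]. apply ccont_comp; [apply Hg | apply Ce]. }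
  assert (K : forall x, vint F x = vint F x0).
  { apply vint_const; [assumption | |].
    - intros t. unfold F. now rewrite cexp_period.
    - intros z Hz. apply cdiff_mult; [|apply cdiff_cexp].
      apply cdiff_comp; [|apply cdiff_cexp]. apply Hd; [apply cexp_neq_0|].
      rewrite Cmod_cexp. intros E. apply exp_inv in E. contradiction. }
  destruct (Hg 0%C 1 Rlt_0_1) as [d [Hdp H]].
  intros x. rewrite K. apply Cmod_eq_0, Rle_antisym; [|apply Cmod_ge_0].
  apply le_epsilon. intros eps Heps. rewrite Rplus_0_l.
  set (B := Cmod (g 0%C) + 1). assert (HB : 0 < B) by (unfold B; assert (Q := Cmod_ge_0 (g 0%C)); lra).
  set (r := Rmin (d / 2) (eps / (2 * PI * B))).
  assert (Hr : 0 < r) by (apply Rmin_glb_lt; [lra | apply Rdiv_lt_0_compat; nra]).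
  rewrite <- (K (ln r)).
  apply Rle_trans with ((2 * PI - 0) * (B * r)).
  - apply CInt_norm_le_const; [lra | now apply pcont_vertical |].
    intros t _. unfold F. rewrite Cmod_mult, Cmod_cexp; simpl fst. rewrite exp_ln by assumption.
    apply Rmult_le_compat_r; [lra|].
    assert (T := Cmod_triangle_rev (g (cexp (ln r, t))) (g 0%C)).
    assert (Z : Cmod (cexp (ln r, t) - 0) < d).
    { replace (cexp (ln r, t) - 0)%C with (cexp (ln r, t)) by ring.
      rewrite Cmod_cexp; simpl. rewrite exp_ln by assumption.
      apply Rle_lt_trans with (1 := Rmin_l _ _). lra. }
    specialize (H _ Z). unfold B. lra.
  - assert (R2 := Rmin_r (d / 2) (eps / (2 * PI * B))). fold r in R2.
    apply Rmult_le_compat_l with (r := 2 * PI * B) in R2; [|nra].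
    replace (2 * PI * B * (eps / (2 * PI * B))) with eps in R2 by (field; lra). lra.
Qed.

(** The difference quotient of [f] at [w]; [l] fills the removable singularity and will be the
    derivative there. *)
Definition dquot (f : C -> C) (w l z : C) : C :=
  if Ceq_dec z w then l else ((f z - f w) / (z - w))%C.

Lemma cdiff_ext_loc (f g : C -> C) (z : C) (d : R) : 0 < d ->
  (forall w, Cmod (w - z) < d -> f w = g w) -> cdiff f z -> cdiff g z.
Proof.
  intros Hd E [l Hl]. exists l. intros eps Heps. destruct (Hl eps Heps) as [d' [Hd' H]].
  exists (Rmin d d'). split; [now apply Rmin_glb_lt|]. intros w Hw.
  rewrite <- !E; [apply H | |].
  - apply (Rlt_le_trans _ _ _ Hw (Rmin_r _ _)).
  - unfold Cminus. rewrite Cplus_opp_r, Cmod_0. assumption.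
  - apply (Rlt_le_trans _ _ _ Hw (Rmin_l _ _)).
Qed.

Lemma cdiff_dquot (f : C -> C) (w l z : C) : (forall u, cdiff f u) -> z <> w ->
  cdiff (dquot f w l) z.
Proof.
  intros Hf Hz.
  assert (P : 0 < Cmod (z - w)) by (apply Cmod_gt_0, Cminus_eq_contra; assumption).
  apply (cdiff_ext_loc (fun u => (f u + - f w) * / (- w + 1 * u))%C _ _ (Cmod (z - w))%C).
  - assumption.
  - intros u Hu. unfold dquot. destruct (Ceq_dec u w) as [->|Hw].
    + rewrite Cmod_sub_sym in Hu. lra.
    + replace (- w + 1 * u)%C with (u - w)%C by ring. reflexivity.
  - apply cdiff_mult.
    + apply cdiff_plus; [apply Hf | apply cdiff_const].
    + apply (cdiff_comp Cinv); [|apply cdiff_affine].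
      apply cdiff_inv. replace (- w + 1 * z)%C with (z - w)%C by ring.
      now apply Cminus_eq_contra.
Qed.

(** At [w] this is the definition of the derivative. Only continuity is obtained there, which is
    what [vint_zero] asks for on its exceptional circle. *)
Lemma dquot_cont (f : C -> C) (w : C) : (forall u, cdiff f u) ->
  exists l, forall z, ccont (dquot f w l) z.
Proof.
  intros Hf. destruct (Hf w) as [l Hl]. exists l. intros z.
  destruct (Ceq_dec z w) as [->|Hz]; [|now apply ccont_of_cdiff, cdiff_dquot].
  intros eps Heps. destruct (Hl (eps / 2) ltac:(lra)) as [d [Hd H]].
  exists d. split; [assumption|]. intros u Hu. unfold dquot.
  destruct (Ceq_dec w w) as [_|N]; [|now destruct N].
  destruct (Ceq_dec u w) as [E|N].
  - replace (l - l)%C with (RtoC 0) by ring. rewrite Cmod_0. assumption.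
  - assert (N' := Cminus_eq_contra _ _ N). assert (P := proj1 (Cmod_gt_0 _) N').
    replace ((f u - f w) / (u - w) - l)%C with ((f u - f w - l * (u - w)) / (u - w))%C by (field; assumption).
    rewrite Cmod_div by assumption. specialize (H u Hu).
    apply Rle_lt_trans with (eps / 2); [|lra].
    apply Rmult_le_reg_r with (Cmod (u - w)); [assumption|].
    unfold Rdiv at 1. rewrite Rmult_assoc, Rinv_l by lra. lra.
Qed.

(** * Taylor coefficients and their bounds *)

Definition centire (f : C -> C) : Prop := forall z, cdiff f z.

Definition kernel (f : C -> C) (k : nat) (s : C) : C := (f (cexp s) * cexp (- s) ^ k)%C.

(* The Taylor coefficient of index [k], as a Fourier coefficient of [f] on the
   unit circle. *)
Definition coef (f : C -> C) (k : nat) : C := (/ RtoC (2 * PI) * vint (kernel f k) 0)%C.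

Fixpoint psum (a : nat -> C) (w : C) (n : nat) : C :=
  match n with O => 0%C | S m => (psum a w m + a m * w ^ m)%C end.

Lemma cdiff_cexp_opp (z : C) : cdiff (fun s => cexp (- s)) z.
Proof.
  apply (cdiff_comp cexp (fun s => (- s)%C)); [apply cdiff_cexp|].
  apply cdiff_ext with (2 := cdiff_affine 0 (- (1)) z). intros w. ring.
Qed.

(** On a circle about 0, [1 / z] is the conjugate of [z] divided by [|z| ^ 2]; this turns negative
    powers into conjugates of positive ones. *)
Lemma cexp_opp_circle (x t : R) :
  cexp (- (x, t)) = (RtoC (exp (- x) * exp (- x)) * Cconj (cexp (x, t)))%C.
Proof.
  unfold cexp, Cconj, Cmult, Copp, RtoC; simpl. rewrite cos_neg, sin_neg.
  assert (E : exp (- x) * exp (- x) * exp x = exp (- x)).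
  { rewrite Rmult_assoc, <- exp_plus, Rplus_opp_l, exp_0. ring. }
  f_equal; rewrite <- E at 1; ring.
Qed.

Lemma cdiff_kernel (f : C -> C) (k : nat) : centire f -> centire (kernel f k).
Proof.
  intros Hf z. unfold kernel. apply cdiff_mult.
  - apply cdiff_comp; [apply Hf | apply cdiff_cexp].
  - apply cdiff_pow, cdiff_cexp_opp.
Qed.

Lemma pcont_circle (g : C -> C) (x : R) : centire g -> pcont (fun t => g (x, t)).
Proof. intros Hg. apply pcont_vertical. intros w. apply ccont_of_cdiff, Hg. Qed.

Lemma RtoC_2PI_neq_0 : RtoC (2 * PI) <> 0%C.
Proof. intros E. apply RtoC_inj in E. assert (P := PI_RGT_0). lra. Qed.

(** In the logarithmic coordinate the pole of [f z / z ^ k] at 0 has disappeared: [kernel f k] is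
    entire and periodic, so every radius gives the same coefficient. *)
Lemma vint_kernel (f : C -> C) (k : nat) (x : R) : centire f ->
  vint (kernel f k) x = (RtoC (2 * PI) * coef f k)%C.
Proof.
  intros Hf. unfold coef. rewrite Cmult_assoc, Cinv_r, Cmult_1_l by apply RtoC_2PI_neq_0.
  apply vint_const.
  - intros z. now apply ccont_of_cdiff, cdiff_kernel.
  - intros t. unfold kernel. rewrite !cexp_opp_circle. now rewrite !cexp_period.
  - intros z _. now apply cdiff_kernel.
Qed.

(** The conjugate of [f] has no positive frequencies: the integral is a real multiple of the
    conjugate of that of [f z * z ^ k], which is the circle integral of [f z * z ^ (k - 1) dz] up to
    a factor and vanishes. *)
Lemma vint_conj_kernel (f : C -> C) (k : nat) (x : R) : centire f -> (1 <= k)%nat ->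
  CInt (fun t => Cconj (f (cexp (x, t))) * cexp (- (x, t)) ^ k)%C 0 (2 * PI) = 0%C.
Proof.
  intros Hf Hk. destruct k as [|k]; [lia|].
  assert (Z : vint (fun s => (fun z => f z * z ^ k) (cexp s) * cexp s)%C x = 0%C).
  { assert (D : centire (fun z => f z * z ^ k)%C).
    { intros z. apply cdiff_mult; [apply Hf | apply (cdiff_pow (fun z => z)), cdiff_id]. }
    apply (vint_zero (fun z => f z * z ^ k)%C 0); intros z; [apply ccont_of_cdiff, D | intros _ _; apply D]. }
  rewrite (CInt_ext _ (fun t => RtoC (exp (- x) * exp (- x)) ^ S k
    * Cconj (f (cexp (x, t)) * cexp (x, t) ^ k * cexp (x, t)))%C).
  2: { intros t. rewrite cexp_opp_circle, Cpow_mult_l, !Cmult_conj, Cpow_conj. simpl. ring. }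
  assert (D : centire (fun s => f (cexp s) * cexp s ^ k * cexp s)%C).
  { intros z. apply cdiff_mult; [|apply cdiff_cexp]. apply cdiff_mult.
    - apply cdiff_comp; [apply Hf | apply cdiff_cexp].
    - apply cdiff_pow, cdiff_cexp. }
  assert (Pc := pcont_circle _ x D).
  rewrite CInt_scal by now apply pcont_conj. rewrite (CInt_conj (fun t => f (cexp (x, t)) * cexp (x, t) ^ k * cexp (x, t))%C) by assumption.
  unfold vint in Z. rewrite Z.
  unfold Cconj, Cmult, RtoC; simpl. f_equal; ring.
Qed.

Lemma coef_const (c : C) (k : nat) : coef (fun _ => c) k = if Nat.eqb k 0 then c else 0%C.
Proof.
  unfold coef. destruct k as [|k]; simpl.
  - unfold vint, kernel. rewrite (CInt_ext _ (fun _ => c)) by (intros t; simpl; ring).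
    rewrite CInt_const, Rminus_0_r, Cmult_assoc, Cinv_l by apply RtoC_2PI_neq_0. ring.
  - unfold vint, kernel.
    (* The constant is written as a conjugate so that the vanishing of positive frequencies
       applies. *)
    rewrite (CInt_ext _ (fun t => Cconj (Cconj c) * cexp (- (0, t)) ^ S k)%C)
      by (intros t; now rewrite Cconj_conj).
    rewrite (vint_conj_kernel (fun _ => Cconj c)); [ring | | lia].
    intros z. apply cdiff_const.
Qed.

Lemma vint_plus_scal (f g : C -> C) (c : C) (x : R) : centire f -> centire g ->
  vint (fun s => f s + c * g s)%C x = (vint f x + c * vint g x)%C.
Proof.
  intros Hf Hg. unfold vint. rewrite CInt_plus, CInt_scal; try reflexivity.
  - now apply pcont_circle.
  - now apply pcont_circle.
  - apply pcont_mult; [apply pcont_const | now apply pcont_circle].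
Qed.

Lemma coef_sub_const (f : C -> C) (c : C) (k : nat) : centire f ->
  coef (fun z => f z - c)%C k = (coef f k - coef (fun _ => c) k)%C.
Proof.
  intros Hf. unfold coef.
  assert (E : vint (kernel (fun z => f z - c)%C k) 0
    = vint (fun s => kernel f k s + - (1) * kernel (fun _ => c) k s)%C 0).
  { apply CInt_ext. intros t. unfold kernel. ring. }
  rewrite E, vint_plus_scal; [ring | |]; apply cdiff_kernel; [assumption|].
  intros z. apply cdiff_const.
Qed.

Lemma psum_ext (a b : nat -> C) (w : C) (n : nat) : (forall k, a k = b k) ->
  psum a w n = psum b w n.
Proof. intros E. induction n as [|n IH]; simpl; [reflexivity | now rewrite IH, E]. Qed.

Lemma psum_minus (a b : nat -> C) (w : C) (n : nat) :
  psum (fun k => a k - b k)%C w n = (psum a w n - psum b w n)%C.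
Proof. induction n as [|n IH]; simpl; [ring | rewrite IH; ring]. Qed.

Lemma psum_const (c w : C) (n : nat) : (1 <= n)%nat ->
  psum (fun k => if Nat.eqb k 0 then c else 0%C) w n = c.
Proof.
  intros Hn. destruct n as [|n]; [lia|]. clear Hn.
  induction n as [|n IH]; [simpl; ring|].
  change (psum (fun k => if Nat.eqb k 0 then c else 0%C) w (S n) + 0 * w ^ S n = c)%C.
  rewrite IH. ring.
Qed.

Lemma geometric_psum (u : C) (n : nat) : ((1 - u) * psum (fun _ => 1%C) u n = 1 - u ^ n)%C.
Proof. induction n as [|n IH]; simpl; [ring | rewrite Cmult_plus_distr_l, IH; ring]. Qed.

Lemma cdiff_psum (a : nat -> C) (g : C -> C) (n : nat) : centire g ->
  centire (fun s => psum a (g s) n).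
Proof.
  intros Hg z. induction n as [|n IH]; simpl; [apply cdiff_const|].
  apply cdiff_plus; [assumption|]. apply cdiff_mult; [apply cdiff_const|].
  apply cdiff_pow, Hg.
Qed.

(** The truncated Cauchy kernel: with [z = cexp s], the inner sum is the geometric series of [w / z]
    cut after [n] terms. *)
Lemma vint_geometric (f : C -> C) (w : C) (n : nat) (x : R) : centire f ->
  vint (fun s => f (cexp s) * psum (fun _ => 1) (w * cexp (- s)) n)%C x
  = (RtoC (2 * PI) * psum (coef f) w n)%C.
Proof.
  intros Hf.
  assert (D : centire (fun s => w * cexp (- s))%C)
    by (intros z; apply cdiff_mult; [apply cdiff_const | apply cdiff_cexp_opp]).
  induction n as [|n IH].
  - simpl. unfold vint. rewrite (CInt_ext _ (fun _ => 0%C)) by (intros t; ring).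
    rewrite CInt_const. ring.
  - assert (E : vint (fun s => f (cexp s) * psum (fun _ => 1) (w * cexp (- s)) (S n))%C x
      = vint (fun s => f (cexp s) * psum (fun _ => 1) (w * cexp (- s)) n + w ^ n * kernel f n s)%C x).
    { apply CInt_ext. intros t. unfold kernel. simpl psum. rewrite Cpow_mult_l. ring. }
    rewrite E, vint_plus_scal, IH, vint_kernel; try assumption.
    + simpl. ring.
    + intros z. apply cdiff_mult; [apply cdiff_comp; [apply Hf | apply cdiff_cexp]|].
      now apply (cdiff_psum (fun _ => 1%C)).
    + now apply cdiff_kernel.
Qed.

(** The normalisation [h w = 0] reduces Cauchy's formula to Cauchy's theorem: [h z / (z - w)]
    extends continuously, so its circle integral vanishes. With [u = w / z] the full kernel is
    [z / (z - w) = 1 / (1 - u)], and the truncated geometric series differs from it by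
    [u ^ n / (1 - u)]. *)
Lemma psum_coef_at_zero (h : C -> C) (w : C) (M x : R) (n : nat) : centire h -> h w = 0%C ->
  Cmod w < exp x -> (forall z, Cmod z = exp x -> Cmod (h z) <= M) ->
  Cmod (psum (coef h) w n) <= M * (Cmod w / exp x) ^ n / (1 - Cmod w / exp x).
Proof.
  intros Hh Hw Hx HM. assert (P := PI_RGT_0). assert (Px := exp_pos x).
  set (q := Cmod w / exp x).
  assert (Hq : 0 <= q < 1).
  { unfold q. split; [apply Rdiv_le_0_compat; [apply Cmod_ge_0 | assumption]|].
    apply Rmult_lt_reg_r with (exp x); [assumption|].
    unfold Rdiv. rewrite Rmult_assoc, Rinv_l; lra. }
  destruct (dquot_cont h w Hh) as [l Hl].
  assert (Z : vint (fun s => dquot h w l (cexp s) * cexp s)%C x = 0%C).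
  (* The doubtful point [w] lies on the exceptional circle if it is not 0; if it is 0, the condition
     [z <> 0] already excludes it. *)
  { apply (vint_zero (dquot h w l) (ln (Cmod w))); [assumption|]. intros z Hz0 Hz. apply cdiff_dquot; [assumption|].
    intros ->. apply Hz. symmetry. apply exp_ln. now apply Cmod_gt_0. }
  assert (D : centire (fun s => h (cexp s) * psum (fun _ => 1) (w * cexp (- s)) n)%C).
  { intros z. apply cdiff_mult; [apply cdiff_comp; [apply Hh | apply cdiff_cexp]|].
    apply (cdiff_psum (fun _ => 1%C)). intros u. apply cdiff_mult; [apply cdiff_const | apply cdiff_cexp_opp]. }
  assert (Cd : forall z, ccont (fun s => dquot h w l (cexp s) * cexp s)%C z).
  { intros z. assert (Ce : ccont cexp z) by apply ccont_of_cdiff, cdiff_cexp.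
    apply ccont_mult; [apply ccont_comp; [apply Hl | assumption] | assumption]. }
  assert (B : Cmod (CInt (fun t => h (cexp (x, t)) * psum (fun _ => 1) (w * cexp (- (x, t))) n
      + - (1) * (dquot h w l (cexp (x, t)) * cexp (x, t)))%C 0 (2 * PI))
      <= (2 * PI - 0) * (M * q ^ n / (1 - q))).
  { apply CInt_norm_le_const; [lra | |].
    - apply pcont_plus; [apply (pcont_circle _ x D)|].
      apply pcont_mult; [apply pcont_const | exact (pcont_vertical _ x Cd)].
    - intros t _. set (z := cexp (x, t)).
      assert (Hz : Cmod z = exp x) by (unfold z; now rewrite Cmod_cexp).
      assert (Hz0 : z <> 0%C) by apply cexp_neq_0.
      assert (Ei : cexp (- (x, t)) = (/ z)%C).
      { rewrite <- (Cmult_1_l (cexp (- (x, t)))), <- (Cinv_l z Hz0), <- Cmult_assoc.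
        unfold z at 2. rewrite cexp_opp. ring. }
      rewrite Ei. unfold dquot. destruct (Ceq_dec z w) as [E|N]; [rewrite <- E in Hx; lra|].
      rewrite Hw. set (u := (w * / z)%C).
      assert (Hu : Cmod u = q) by (unfold u; rewrite Cmod_mult, Cmod_inv, Hz by assumption; reflexivity).
      assert (Hu1 : 1 - q <= Cmod (1 - u)).
      { assert (T := Cmod_triangle_rev 1 u). rewrite Cmod_1, Hu in T. exact T. }
      assert (Nu : (1 - u)%C <> 0%C) by (apply Cmod_gt_0; lra).
      assert (Eg : (h z * psum (fun _ => 1) u n + - (1) * ((h z - 0) / (z - w) * z)
        = - (h z * u ^ n) / (1 - u))%C).
      { assert (G := geometric_psum u n).
        assert (Ew : w = (u * z)%C) by (unfold u; field; assumption).
        assert (Nz : (z - w)%C <> 0%C) by now apply Cminus_eq_contra.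
        replace (psum (fun _ => 1%C) u n) with ((1 - u ^ n) / (1 - u))%C
          by (rewrite <- G; field; assumption).
        replace ((h z - 0) / (z - w) * z)%C with (h z / (1 - u))%C; [field; assumption|].
        replace (z - w)%C with (z * (1 - u))%C by (rewrite Ew; ring).
        field. split; assumption. }
      rewrite Eg, Cmod_div, Cmod_opp, Cmod_mult, Cmod_pow, Hu by assumption.
      unfold Rdiv. assert (Pq : 0 <= q ^ n) by (apply pow_le; lra).
      apply Rmult_le_compat.
      + apply Rmult_le_pos; [apply Cmod_ge_0 | assumption].
      + left. apply Rinv_0_lt_compat. lra.
      + apply Rmult_le_compat_r; [assumption | now apply HM].
      + apply Rinv_le_contravar; lra. }
  rewrite CInt_plus, CInt_scal in B.
  - unfold vint in Z. rewrite Z in B.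
    assert (V := vint_geometric h w n x Hh). unfold vint in V. rewrite V in B.
    replace (RtoC (2 * PI) * psum (coef h) w n + - (1) * 0)%C
      with (RtoC (2 * PI) * psum (coef h) w n)%C in B by ring.
    rewrite Cmod_mult, Cmod_RtoC_pos in B by lra.
    apply Rmult_le_reg_l with (2 * PI); lra.
  - exact (pcont_vertical _ x Cd).
  - apply (pcont_circle _ x D).
  - apply pcont_mult; [apply pcont_const | exact (pcont_vertical _ x Cd)].
Qed.

(** The previous bound for [f - f w], which is at most [2 * M] and differs from [f] only in the
    coefficient of index 0; with [1 <= n] that coefficient occurs in the partial sum. *)
Lemma taylor_remainder (f : C -> C) (w : C) (M r : R) (n : nat) : centire f ->
  Cmod w < r -> (forall z, Cmod z <= r -> Cmod (f z) <= M) -> (1 <= n)%nat ->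
  Cmod (f w - psum (coef f) w n) <= 2 * M * (Cmod w / r) ^ n / (1 - Cmod w / r).
Proof.
  intros Hf Hw HM Hn.
  assert (Hr : 0 < r) by (assert (Q := Cmod_ge_0 w); lra).
  assert (Er : exp (ln r) = r) by now apply exp_ln.
  assert (Dh : centire (fun z => f z - f w)%C).
  { intros z. apply cdiff_plus; [apply Hf | apply cdiff_const]. }
  assert (B := psum_coef_at_zero (fun z => f z - f w)%C w (2 * M) (ln r) n Dh).
  rewrite Er in B.
  rewrite (psum_ext _ (fun k => coef f k - (if Nat.eqb k 0 then f w else 0))%C) in B.
  2: { intros k. rewrite coef_sub_const, coef_const by assumption. reflexivity. }
  rewrite (psum_minus (coef f)), psum_const in B by assumption.
  rewrite Cmod_sub_sym. apply B; [ring | assumption |].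
  intros z Hz. apply Rle_trans with (1 := Cmod_sub_triangle _ _).
  assert (H1 := HM z ltac:(lra)). assert (H2 := HM w ltac:(lra)). lra.
Qed.

(** Cauchy's estimate, by evaluating the coefficient on the circle of radius [r] instead of the unit
    circle. *)
Lemma coef_bound (f : C -> C) (M r : R) (k : nat) : centire f -> 0 < r ->
  (forall z, Cmod z = r -> Cmod (f z) <= M) -> Cmod (coef f k) * r ^ k <= M.
Proof.
  intros Hf Hr HM. assert (P := PI_RGT_0).
  assert (Er : exp (ln r) = r) by now apply exp_ln.
  assert (Pr : 0 < r ^ k) by now apply pow_lt.
  assert (B : Cmod (vint (kernel f k) (ln r)) <= (2 * PI - 0) * (M * / r ^ k)).
  { apply CInt_norm_le_const; [lra | apply pcont_circle; now apply cdiff_kernel |].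
    intros t _. unfold kernel. rewrite Cmod_mult, Cmod_pow, Cmod_cexp. simpl.
    rewrite exp_Ropp, Er, pow_inv.
    apply Rmult_le_compat_r; [left; now apply Rinv_0_lt_compat|].
    apply HM. rewrite Cmod_cexp. exact Er. }
  rewrite vint_kernel, Cmod_mult, Cmod_RtoC_pos in B by (assumption || lra).
  assert (B' : Cmod (coef f k) <= M * / r ^ k) by (apply Rmult_le_reg_l with (2 * PI); lra).
  apply Rmult_le_compat_r with (r := r ^ k) in B'; [|lra].
  rewrite Rmult_assoc, Rinv_l in B' by lra. lra.
Qed.

(** At [w = 0] the remainder after one term is a multiple of [0 ^ 1]. *)
Lemma coef_0 (f : C -> C) : centire f -> coef f 0 = f 0%C.
Proof.
  intros Hf.
  destruct (ccont_bounded f 1 (fun z => ccont_of_cdiff f z (Hf z))) as [M HM].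
  assert (B := taylor_remainder f 0 M 1 1 Hf).
  rewrite Cmod_0 in B. specialize (B Rlt_0_1 HM (le_n _)).
  simpl in B. replace (2 * M * (0 / 1 * 1) / (1 - 0 / 1)) with 0 in B by field.
  assert (E : (f 0 - (0 + coef f 0 * 1) = 0)%C).
  { apply Cmod_eq_0, Rle_antisym; [assumption | apply Cmod_ge_0]. }
  symmetry. apply Ceq_minus. transitivity (f 0 - (0 + coef f 0 * 1))%C; [ring | exact E].
Qed.

(* Borel--Caratheodory at the level of coefficients: adding to [f] its conjugate
   and a constant does not change the coefficient of index [k >= 1] of the
   Fourier series on the circle, and turns the integrand into [2 (Re f - M)],
   which has a sign. *)
Lemma coef_re_bound (f : C -> C) (M r : R) (k : nat) : centire f -> 0 < r -> (1 <= k)%nat ->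
  (forall z, Cmod z = r -> fst (f z) <= M) ->
  Cmod (coef f k) * r ^ k <= 2 * (M - fst (f 0%C)).
Proof.
  intros Hf Hr Hk HM. assert (P := PI_RGT_0).
  assert (Er : exp (ln r) = r) by now apply exp_ln.
  assert (Pr : 0 < r ^ k) by now apply pow_lt.
  set (x := ln r) in *.
  assert (Df : centire (fun s => f (cexp s)))
    by (intros z; apply cdiff_comp; [apply Hf | apply cdiff_cexp]).
  assert (Dk : centire (fun s => cexp (- s) ^ k)%C)
    by (intros z; apply cdiff_pow, cdiff_cexp_opp).
  assert (Pf := pcont_circle _ x Df). assert (Pk := pcont_circle _ x Dk). simpl in Pf, Pk.
  assert (E : (RtoC (2 * PI) * coef f k = CInt (fun t => f (cexp (x, t)) * cexp (- (x, t)) ^ k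
    + (Cconj (f (cexp (x, t))) * cexp (- (x, t)) ^ k
       + RtoC (- 2 * M) * cexp (- (x, t)) ^ k)) 0 (2 * PI))%C).
  { rewrite CInt_plus, CInt_plus, CInt_scal, vint_conj_kernel; try assumption.
    - assert (Z := vint_conj_kernel (fun _ => 1%C) k x (fun z => cdiff_const _ z) Hk).
      rewrite (CInt_ext _ (fun t => cexp (- (x, t)) ^ k)%C) in Z.
      2: { intros t. replace (Cconj 1) with (RtoC 1); [ring|].
           unfold Cconj, RtoC; simpl. f_equal; ring. }
      rewrite Z. rewrite <- (vint_kernel f k x Hf). unfold vint, kernel. ring.
    - apply pcont_mult; [now apply pcont_conj | assumption].
    - apply pcont_mult; [apply pcont_const | assumption].
    - now apply pcont_mult.
    - apply pcont_plus; [apply pcont_mult; [now apply pcont_conj | assumption]|].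
      apply pcont_mult; [apply pcont_const | assumption]. }
  assert (Cf : forall t, continuous (fun t => fst (f (cexp (x, t)))) t) by (intros t; apply (Pf t)).
  assert (B : Cmod (RtoC (2 * PI) * coef f k)
    <= RInt (fun t => 2 / r ^ k * (M - fst (f (cexp (x, t))))) 0 (2 * PI)).
  { rewrite E. apply CInt_norm_le; [lra | | |].
    - apply pcont_plus; [now apply pcont_mult|].
      apply pcont_plus; [apply pcont_mult; [now apply pcont_conj | assumption]|].
      apply pcont_mult; [apply pcont_const | assumption].
    - intros t. apply (@continuous_scal_r _ R_AbsRing R_NormedModule).
      apply (@continuous_minus _ R_AbsRing R_NormedModule); [apply continuous_const | apply Cf].
    - intros t _.
      replace (f (cexp (x, t)) * cexp (- (x, t)) ^ k + (Cconj (f (cexp (x, t))) * cexp (- (x, t)) ^ k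
        + RtoC (- 2 * M) * cexp (- (x, t)) ^ k))%C
        with (RtoC (- (2 * (M - fst (f (cexp (x, t)))))) * cexp (- (x, t)) ^ k)%C.
      2: { replace (RtoC (- (2 * (M - fst (f (cexp (x, t)))))))
             with (f (cexp (x, t)) + Cconj (f (cexp (x, t))) + RtoC (- 2 * M))%C; [ring|].
           unfold Cconj, Cplus, RtoC; simpl. f_equal; ring. }
      assert (Hz := HM (cexp (x, t)) ltac:(rewrite Cmod_cexp; exact Er)).
      rewrite Cmod_mult, Cmod_pow, Cmod_cexp, Cmod_R, Rabs_Ropp, Rabs_pos_eq by lra.
      simpl. rewrite exp_Ropp, Er, pow_inv. right. field. lra. }
  (* The mean value property: the integral of [Re f] is the real part of the coefficient of index 0,
     which is [f 0]. *)
  assert (I : RInt (fun t => 2 / r ^ k * (M - fst (f (cexp (x, t))))) 0 (2 * PI)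
    = 2 / r ^ k * (2 * PI * (M - fst (f 0%C)))).
  { assert (Ef : ex_RInt (fun t => fst (f (cexp (x, t)))) 0 (2 * PI)) by now apply (pcont_ex_RInt _ _ _ Pf).
    assert (Ec : ex_RInt (fun _ : R => M) 0 (2 * PI)) by apply ex_RInt_const.
    assert (Em := @ex_RInt_minus R_NormedModule _ _ _ _ Ec Ef).
    assert (S1 := @RInt_scal R_CompleteNormedModule _ 0 (2 * PI) (2 / r ^ k) Em).
    assert (S2 := @RInt_minus R_CompleteNormedModule _ _ _ _ Ec Ef).
    transitivity (2 / r ^ k * RInt (fun t => M - fst (f (cexp (x, t)))) 0 (2 * PI)); [exact S1|].
    f_equal.
    transitivity (RInt (fun _ : R => M) 0 (2 * PI) - RInt (fun t => fst (f (cexp (x, t)))) 0 (2 * PI));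
      [exact S2|].
    assert (K0 := vint_kernel f 0 x Hf). rewrite coef_0 in K0 by assumption.
    apply (f_equal fst) in K0. unfold vint, kernel in K0.
    rewrite (CInt_ext _ (fun t => f (cexp (x, t)))) in K0 by (intros t; simpl; ring).
    unfold CInt, Cmult in K0; simpl in K0. 
    assert (K1 : RInt (fun t => fst (f (cexp (x, t)))) 0 (2 * PI) = 2 * PI * fst (f 0%C)) by lra.
    assert (K2 : RInt (fun _ : R => M) 0 (2 * PI) = (2 * PI - 0) * M)
      by apply (@RInt_const R_CompleteNormedModule).
    rewrite K1, K2. as_real_eq. ring. }
  rewrite I, Cmod_mult, Cmod_RtoC_pos in B by lra.
  apply Rmult_le_reg_l with (2 * PI / r ^ k); [apply Rdiv_lt_0_compat; lra|].
  replace (2 * PI / r ^ k * (Cmod (coef f k) * r ^ k)) with (2 * PI * Cmod (coef f k)) by (field; lra).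
  apply Rle_trans with (1 := B). right. field. lra.
Qed.

(** * Growth of transcendental entire functions *)

Lemma geometric_small (q A eps : R) : 0 < q < 1 -> 0 < eps ->
  exists n, (1 <= n)%nat /\ A * q ^ n <= eps.
Proof.
  intros Hq Heps.
  assert (HA := Rabs_pos A).
  assert (He : 0 < eps / (Rabs A + 1)) by (apply Rdiv_lt_0_compat; lra).
  destruct (pow_lt_1_zero q ltac:(rewrite Rabs_pos_eq; lra) _ He) as [n Hn].
  exists (S n). split; [lia|]. specialize (Hn (S n) ltac:(lia)).
  assert (P : 0 < q ^ S n) by (apply pow_lt; lra).
  rewrite Rabs_pos_eq in Hn by lra.
  apply Rmult_lt_compat_l with (r := Rabs A + 1) in Hn; [|lra].
  replace ((Rabs A + 1) * (eps / (Rabs A + 1))) with eps in Hn by (field; lra).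
  assert (Q := Rle_abs A). nra.
Qed.

Lemma taylor_remainder_half (f : C -> C) (w : C) (M r : R) (n : nat) : centire f ->
  0 < r -> Cmod w <= r / 2 -> (forall z, Cmod z <= r -> Cmod (f z) <= M) -> (1 <= n)%nat ->
  Cmod (f w - psum (coef f) w n) <= 4 * M * (1 / 2) ^ n.
Proof.
  intros Hf Hr Hw HM Hn.
  apply Rle_trans with (1 := taylor_remainder f w M r n Hf ltac:(lra) HM Hn).
  assert (HM0 : 0 <= M).
  { apply Rle_trans with (Cmod (f 0%C)); [apply Cmod_ge_0 | apply HM; rewrite Cmod_0; lra]. }
  assert (Hq : 0 <= Cmod w / r <= 1 / 2).
  { split; [apply Rdiv_le_0_compat; [apply Cmod_ge_0 | assumption]|].
    apply Rmult_le_reg_r with r; [assumption|]. unfold Rdiv. rewrite Rmult_assoc, Rinv_l; lra. }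
  assert (P := pow_incr _ _ n Hq).
  assert (P0 : 0 <= (Cmod w / r) ^ n) by (apply pow_le; lra).
  apply Rmult_le_reg_r with (1 - Cmod w / r); [lra|].
  unfold Rdiv at 1. rewrite Rmult_assoc, Rinv_l, Rmult_1_r by lra.
  apply Rle_trans with (2 * M * (1 / 2) ^ n); [apply Rmult_le_compat_l; lra|].
  assert (0 <= M * (1 / 2) ^ n) by (apply Rmult_le_pos; [|apply pow_le]; lra).
  nra.
Qed.

(** The mean value bound [k m ^ (k - 1) |s - t|], multiplied by [m] so that the exponent [k - 1]
    does not occur. *)
Lemma Cpow_sub_le (s t : C) (m : R) (k : nat) : Cmod s <= m -> Cmod t <= m ->
  Cmod (s ^ k - t ^ k) * m <= INR k * m ^ k * Cmod (s - t).
Proof.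
  intros Hs Ht. assert (Hm : 0 <= m) by (apply Rle_trans with (2 := Hs), Cmod_ge_0).
  induction k as [|k IH].
  - replace (s ^ 0 - t ^ 0)%C with (RtoC 0) by (simpl; ring). rewrite Cmod_0. simpl. lra.
  - replace (s ^ S k - t ^ S k)%C with (s * (s ^ k - t ^ k) + (s - t) * t ^ k)%C by (simpl; ring).
    assert (T := Cmod_triangle (s * (s ^ k - t ^ k)) ((s - t) * t ^ k)).
    rewrite !Cmod_mult, Cmod_pow in T.
    assert (Pt : Cmod t ^ k <= m ^ k) by (apply pow_incr; split; [apply Cmod_ge_0 | assumption]).
    assert (Q := Cmod_ge_0 (s - t)). assert (Q' := Cmod_ge_0 (s ^ k - t ^ k)).
    assert (E1 : Cmod s * Cmod (s ^ k - t ^ k) <= m * Cmod (s ^ k - t ^ k)) by (apply Rmult_le_compat_r; lra).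
    assert (E2 : Cmod (s - t) * Cmod t ^ k <= Cmod (s - t) * m ^ k) by (apply Rmult_le_compat_l; lra).
    apply Rle_trans with ((m * Cmod (s ^ k - t ^ k) + Cmod (s - t) * m ^ k) * m).
    + apply Rmult_le_compat_r; lra.
    + rewrite S_INR. simpl. apply Rmult_le_compat_l with (r := m) in IH; [|lra]. lra.
Qed.

(** [coef_re_bound] gives [|coef g k| <= 2 eps / rho ^ k] for [k >= 1]. Comparing powers on the disc
    of radius [rho / 2] then leaves a multiple of the convergent sum of [k / 2 ^ k], and the Taylor
    remainders at [s] and [t] vanish in the limit. *)
Lemma lipschitz_of_re_bound (g : C -> C) (rho eps : R) : centire g -> 0 < rho ->
  g 0%C = 1%C -> (forall z, Cmod z = rho -> fst (g z) <= 1 + eps) ->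
  forall s t, Cmod s <= rho / 2 -> Cmod t <= rho / 2 ->
  Cmod (g s - g t) <= 8 * eps / rho * Cmod (s - t).
Proof.
  intros Hg Hr H0 Hre s t Hs Ht.
  assert (Hc : forall k, (1 <= k)%nat -> Cmod (coef g k) * rho ^ k <= 2 * eps).
  { intros k Hk. assert (B := coef_re_bound g (1 + eps) rho k Hg Hr Hk Hre).
    rewrite H0 in B. simpl in B. lra. }
  assert (He : 0 <= eps).
  { specialize (Hc 1%nat (le_n _)). assert (Q := Cmod_ge_0 (coef g 1)). simpl in Hc. nra. }
  assert (Q := Cmod_ge_0 (s - t)).
  (* The last factor is the closed form of the sum of [2 k (1/2) ^ k] over [k < n]; its limit 4
     produces the constant 8. *)
  assert (Hsum : forall n, Cmod (psum (coef g) s n - psum (coef g) t n)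
    <= 2 * eps / rho * Cmod (s - t) * (4 - 4 * INR (S n) * (1 / 2) ^ n)).
  { induction n as [|n IH].
    - simpl. replace (0 - 0)%C with (RtoC 0) by ring. rewrite Cmod_0. lra.
    - simpl psum.
      replace (psum (coef g) s n + coef g n * s ^ n - (psum (coef g) t n + coef g n * t ^ n))%C
        with (psum (coef g) s n - psum (coef g) t n + coef g n * (s ^ n - t ^ n))%C by ring.
      apply Rle_trans with (1 := Cmod_triangle _ _). rewrite Cmod_mult.
      assert (K : Cmod (coef g n) * Cmod (s ^ n - t ^ n)
        <= 2 * eps / rho * Cmod (s - t) * (2 * INR n * (1 / 2) ^ n)).
      { destruct n as [|n].
        - simpl. replace (1 - 1)%C with (RtoC 0) by ring. rewrite Cmod_0. lra.
        - assert (B := Cpow_sub_le s t (rho / 2) (S n) Hs Ht).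
          specialize (Hc (S n) ltac:(lia)).
          assert (Pn := pos_INR (S n)).
          assert (Ph : 0 <= (1 / 2) ^ S n) by (apply pow_le; lra).
          replace ((rho / 2) ^ S n) with (rho ^ S n * (1 / 2) ^ S n) in B
            by (rewrite <- Rpow_mult_distr; f_equal; field).
          apply Rmult_le_reg_r with (rho / 2); [lra|].
          rewrite Rmult_assoc.
          apply Rle_trans with (1 := Rmult_le_compat_l _ _ _ (Cmod_ge_0 _) B).
          replace (Cmod (coef g (S n)) * (INR (S n) * (rho ^ S n * (1 / 2) ^ S n) * Cmod (s - t)))
            with (Cmod (coef g (S n)) * rho ^ S n * (INR (S n) * (1 / 2) ^ S n * Cmod (s - t))) by ring.
          replace (2 * eps / rho * Cmod (s - t) * (2 * INR (S n) * (1 / 2) ^ S n) * (rho / 2))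
            with (2 * eps * (INR (S n) * (1 / 2) ^ S n * Cmod (s - t))) by (field; lra).
          apply Rmult_le_compat_r; [|assumption].
          apply Rmult_le_pos; [apply Rmult_le_pos|]; assumption. }
      apply Rle_trans with (1 := Rplus_le_compat _ _ _ _ IH K).
      right. rewrite !S_INR. simpl. field. lra. }
  destruct (ccont_bounded g rho (fun z => ccont_of_cdiff g z (Hg z))) as [M HM].
  apply le_epsilon. intros e Hpos.
  destruct (geometric_small (1 / 2) (8 * M) e ltac:(lra) Hpos) as [n [Hn Hsmall]].
  assert (R1 := taylor_remainder_half g s M rho n Hg Hr Hs HM Hn).
  assert (R2 := taylor_remainder_half g t M rho n Hg Hr Ht HM Hn).
  specialize (Hsum n).
  replace (g s - g t)%C with ((g s - psum (coef g) s n) - (g t - psum (coef g) t n)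
    + (psum (coef g) s n - psum (coef g) t n))%C by ring.
  apply Rle_trans with (1 := Cmod_triangle _ _).
  apply Rle_trans with (1 := Rplus_le_compat_r _ _ _ (Cmod_sub_triangle _ _)).
  assert (F : 2 * eps / rho * Cmod (s - t) * (4 - 4 * INR (S n) * (1 / 2) ^ n)
    <= 2 * eps / rho * Cmod (s - t) * 4).
  { apply Rmult_le_compat_l.
    - apply Rmult_le_pos; [apply Rdiv_le_0_compat; lra | assumption].
    - assert (0 <= INR (S n) * (1 / 2) ^ n)
        by (apply Rmult_le_pos; [apply pos_INR | apply pow_le; lra]). lra. }
  replace (8 * eps / rho * Cmod (s - t)) with (2 * eps / rho * Cmod (s - t) * 4) by (field; lra).
  lra.
Qed.

(** Near-maximisers stand in for maximisers, whence slack factors such as [1 + 1 / 4000] below. *)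
Lemma sup_exists (phi : C -> R) (P : C -> Prop) (B : R) (z0 : C) : P z0 ->
  (forall z, P z -> phi z <= B) ->
  exists M, (forall z, P z -> phi z <= M) /\
    forall M', M' < M -> exists z, P z /\ M' < phi z.
Proof.
  intros Hz0 HB.
  destruct (completeness (fun y => exists z, P z /\ y = phi z)) as [M [HM1 HM2]].
  - exists B. intros y [z [Hz ->]]. now apply HB.
  - exists (phi z0), z0. auto.
  - exists M. split; [intros z Hz; apply HM1; now exists z|].
    intros M' HM'. apply NNPP. intros N.
    assert (K : M <= M'); [|lra].
    apply HM2. intros y [z [Hz ->]]. apply Rnot_lt_le. intros L. apply N. now exists z.
Qed.

Lemma psum_stable (a : nat -> C) (w : C) (n m : nat) :
  (forall k, (n <= k)%nat -> a k = 0%C) -> psum a w (n + m) = psum a w n.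
Proof.
  intros Ha. induction m as [|m IH]; [f_equal; lia|].
  replace (n + S m)%nat with (S (n + m)) by lia. simpl. rewrite IH, Ha by lia. ring.
Qed.

Lemma sum_n_psum (a : nat -> C) (w : C) (n : nat) :
  @sum_n C_AbelianMonoid (fun k => a k * Cpow w k)%C n = psum a w (S n).
Proof.
  induction n as [|n IH].
  - rewrite sum_O. simpl. ring.
  - rewrite sum_Sn, IH. reflexivity.
Qed.

(** If all coefficients from [n] on vanished, the Taylor remainders would tend to 0 along a
    stationary partial sum, and [f] would be that polynomial. *)
Lemma coef_unbounded_support (f : C -> C) (n : nat) : centire f -> ~ is_polynomial f ->
  exists m, (n <= m)%nat /\ coef f m <> 0%C.
Proof.
  intros Hf Hp. apply NNPP. intros N. apply Hp.
  assert (Z : forall k, (n <= k)%nat -> coef f k = 0%C).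
  { intros k Hk. apply NNPP. intros E. apply N. now exists k. }
  exists n, (coef f). intros z. rewrite sum_n_psum.
  apply Ceq_minus, Cmod_eq_0, Rle_antisym; [|apply Cmod_ge_0].
  apply le_epsilon. intros eps Heps. rewrite Rplus_0_l.
  set (r := 2 * (Cmod z + 1)).
  assert (Q := Cmod_ge_0 z).
  destruct (ccont_bounded f r (fun z => ccont_of_cdiff f z (Hf z))) as [M HM].
  destruct (geometric_small (1 / 2) (4 * M) eps ltac:(lra) Heps) as [m [Hm Hsmall]].
  assert (R1 := taylor_remainder_half f z M r (n + m) Hf ltac:(unfold r; lra) ltac:(unfold r; lra) HM ltac:(lia)).
  rewrite psum_stable in R1 by assumption.
  replace (psum (coef f) z (S n)) with (psum (coef f) z n) by (simpl; rewrite Z by lia; ring).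
  apply Rle_trans with (1 := R1). apply Rle_trans with (2 := Hsmall).
  assert (HM0 : 0 <= M).
  { apply Rle_trans with (Cmod (f z)); [apply Cmod_ge_0 | apply HM; unfold r; lra]. }
  apply Rmult_le_compat_l; [lra|]. rewrite pow_add.
  assert (P1 : 0 < (1 / 2) ^ m) by (apply pow_lt; lra).
  assert (P2 : (1 / 2) ^ n <= 1 ^ n) by (apply pow_incr; lra). rewrite pow1 in P2.
  nra.
Qed.

Lemma psum_norm_le (a : nat -> C) (n : nat) : exists K, 0 <= K /\
  forall w r, 1 <= r -> Cmod w <= r -> Cmod (psum a w n) <= K * r ^ n.
Proof.
  induction n as [|n [K [HK IH]]].
  - exists 0. split; [lra|]. intros w r _ _. simpl. rewrite Cmod_0. lra.
  - exists (K + Cmod (a n)). assert (Q := Cmod_ge_0 (a n)). split; [lra|].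
    intros w r Hr Hw. simpl. apply Rle_trans with (1 := Cmod_triangle _ _).
    rewrite Cmod_mult, Cmod_pow.
    assert (P1 : Cmod w ^ n <= r ^ n) by (apply pow_incr; split; [apply Cmod_ge_0 | assumption]).
    assert (P2 : 0 < r ^ n) by (apply pow_lt; lra).
    specialize (IH w r Hr Hw).
    assert (Cmod (a n) * Cmod w ^ n <= Cmod (a n) * r ^ n) by (apply Rmult_le_compat_l; lra).
    assert (0 <= (r - 1) * ((K + Cmod (a n)) * r ^ n)).
    { apply Rmult_le_pos; [lra | apply Rmult_le_pos; lra]. }
    lra.
Qed.

(* If the maximum modulus on radius [2 r] were at most [2 ^ L] times the one on
   radius [r], the Taylor tail beyond order [L + 4] would be a quarter of the
   latter on [|z| <= r], and the fixed head is negligible for large [r]. *)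
Lemma superpolynomial_growth (f : C -> C) (L : nat) (A : R) : centire f -> ~ is_polynomial f ->
  exists r0, 0 < r0 /\ forall r, r0 <= r -> exists w, Cmod w <= 2 * r /\
    (forall z, Cmod z <= r -> 2 ^ L * Cmod (f z) <= Cmod (f w)) /\ A * r <= Cmod (f w).
Proof.
  intros Hf Hp.
  (* Four extra orders: [4 * 2 ^ L * (1 / 2) ^ (L + 4) = 1 / 4]. *)
  set (n := (L + 4)%nat).
  destruct (coef_unbounded_support f (S n) Hf Hp) as [m [Hm Hc]].
  destruct (psum_norm_le (coef f) n) as [K [HK Hhead]].
  apply Cmod_gt_0 in Hc. set (c := Cmod (coef f m)) in *.
  (* The second summand makes the Taylor head at most a quarter of [c r ^ (n + 1)], the third gives
     the lower bound [A * r]. *)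
  set (r0 := 1 + 4 * K / c + Rabs A / c).
  assert (P1 : 0 <= 4 * K / c) by (apply Rdiv_le_0_compat; lra).
  assert (P2 : 0 <= Rabs A / c) by (apply Rdiv_le_0_compat; [apply Rabs_pos | assumption]).
  exists r0. split; [unfold r0; lra|]. intros r Hr.
  assert (Hr1 : 1 <= r) by (unfold r0 in Hr; lra).
  assert (HrK : 4 * K <= c * r).
  { replace (4 * K) with (c * (4 * K / c)) by (field; lra).
    apply Rmult_le_compat_l; unfold r0 in Hr; lra. }
  assert (HrA : A <= c * r).
  { apply Rle_trans with (1 := Rle_abs A). replace (Rabs A) with (c * (Rabs A / c)) by (field; lra).
    apply Rmult_le_compat_l; unfold r0 in Hr; lra. }
  assert (Hb : forall u, exists B, forall z, Cmod z <= u -> Cmod (f z) <= B)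
    by (intros u; apply ccont_bounded; intros z; apply ccont_of_cdiff, Hf).
  assert (Hz0 : forall u, 0 <= u -> Cmod 0 <= u) by (intros u Hu; now rewrite Cmod_0).
  destruct (Hb r) as [B1 HB1]. destruct (Hb (2 * r)) as [B2 HB2].
  destruct (sup_exists (fun z => Cmod (f z)) (fun z => Cmod z <= r) B1 0%C (Hz0 r ltac:(lra)) HB1)
    as [M1 [HM1 HM1']].
  destruct (sup_exists (fun z => Cmod (f z)) (fun z => Cmod z <= 2 * r) B2 0%C (Hz0 (2 * r) ltac:(lra)) HB2)
    as [M2 [HM2 HM2']].
  (* Cauchy's estimate read as a lower bound for the maximum: a nonzero coefficient of index [m > n]
     beats the head, which is of order [r ^ n]. *)
  assert (Hcm : c * r ^ m <= M1).
  { apply (coef_bound f M1 r m Hf ltac:(lra)). intros z Hz. apply HM1. lra. }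
  assert (Pn : r * r ^ n <= r ^ m) by (apply (Rle_pow r (S n) m); [assumption | lia]).
  assert (Pn1 : 1 <= r ^ n) by (apply pow_R1_Rle; assumption).
  assert (HcM : c * (r * r ^ n) <= M1).
  { apply Rle_trans with (2 := Hcm). apply Rmult_le_compat_l; lra. }
  assert (HM1pos : 0 < M1).
  { apply Rlt_le_trans with (2 := HcM). repeat apply Rmult_lt_0_compat; lra. }
  assert (P2L : 1 <= 2 ^ L) by (apply pow_R1_Rle; lra).
  assert (Hgrow : 2 ^ L * M1 < M2).
  { apply Rnot_le_lt. intros Hle.
    assert (Hhalf : forall z, Cmod z <= r -> Cmod (f z) <= M1 / 2).
    { intros z Hz.
      assert (T := taylor_remainder_half f z M2 (2 * r) n Hf ltac:(lra) ltac:(lra) HM2 ltac:(unfold n; lia)).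
      assert (E : (1 / 2) ^ n = / 2 ^ L / 16).
      { unfold n. rewrite pow_add. unfold Rdiv at 1. rewrite Rmult_1_l, pow_inv. simpl. field.
        apply pow_nonzero. lra. }
      assert (T2 : 4 * M2 * (1 / 2) ^ n <= M1 / 4).
      { rewrite E. replace (M1 / 4) with (4 * (2 ^ L * M1) * (/ 2 ^ L / 16)) by (field; lra).
        apply Rmult_le_compat_r; [|lra]. assert (0 < / 2 ^ L) by (apply Rinv_0_lt_compat; lra). lra. }
      specialize (Hhead z r Hr1 Hz).
      assert (Hd : K * r ^ n <= M1 / 4).
      { apply Rmult_le_reg_l with 4; [lra|].
        replace (4 * (K * r ^ n)) with ((4 * K) * r ^ n) by ring.
        replace (4 * (M1 / 4)) with M1 by field.
        apply Rle_trans with (2 := HcM). rewrite <- Rmult_assoc.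
        apply Rmult_le_compat_r; lra. }
      assert (T3 := Cmod_triangle_rev (f z) (psum (coef f) z n)). lra. }
    destruct (HM1' (M1 / 2) ltac:(lra)) as [z [Hz Hz']]. specialize (Hhalf z Hz). lra. }
  destruct (HM2' _ Hgrow) as [w [Hw Hw']].
  exists w. split; [assumption|]. split.
  - intros z Hz. specialize (HM1 z Hz). apply Rle_trans with (2 := Rlt_le _ _ Hw').
    apply Rmult_le_compat_l; lra.
  - apply Rle_trans with M1; [|nra].
    apply Rle_trans with (2 := HcM).
    apply Rle_trans with (c * r * r); [apply Rmult_le_compat_r; lra|].
    rewrite <- Rmult_assoc. apply Rmult_le_compat_l; [nra|].
    replace n with (S (L + 3)) by (unfold n; lia). simpl.
    assert (1 <= r ^ (L + 3)) by (apply pow_R1_Rle; assumption). nra.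
Qed.

(** * Points near which the function looks like an exponential *)

Lemma exp_INR_mult (n : nat) (x : R) : exp (INR n * x) = exp x ^ n.
Proof.
  induction n as [|n IH]; [simpl; rewrite Rmult_0_l; apply exp_0|].
  rewrite S_INR, Rmult_plus_distr_r, Rmult_1_l, exp_plus, IH. simpl. ring.
Qed.

(** This is [- ln (1 - y) <= y + 2 y ^ 2], from [(1 + y + 2 y ^ 2) (1 - y) = 1 + y ^ 2 (1 - 2 y) >=
    1]. It converts the weight [(R - |z|) ^ L] into an exponential. *)
Lemma exp_le_one_sub_pow (y : R) (n : nat) : Rabs y <= 1 / 2 ->
  1 <= exp (INR n * (y + 2 * (y * y))) * (1 - y) ^ n.
Proof.
  intros Hy. apply Rabs_le_between in Hy.
  rewrite exp_INR_mult, <- Rpow_mult_distr. apply pow_R1_Rle.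
  assert (E := exp_ge_linear (y + 2 * (y * y))).
  apply Rle_trans with ((1 + (y + 2 * (y * y))) * (1 - y)); [nra|].
  apply Rmult_le_compat_r; lra.
Qed.

Lemma Cmod_add_sqr (a s : C) :
  Cmod (a + s) * Cmod (a + s)
  = Cmod a * Cmod a + 2 * fst (Cconj a * s)%C + Cmod s * Cmod s.
Proof.
  rewrite !Cmod_sqr. destruct a as [a1 a2], s as [s1 s2]. simpl. ring.
Qed.

(* A point [a] that almost maximises [|f z| (R - |z|) ^ L] over the disc
   [|z| <= R].  With [d = R - |a|], comparing values of the weight gives
   [|f (a + s)| <= (1 + 1/1000) |f a| exp (Re (c s))] for [|s| <= 12 d / L],
   where [c = L conj(a) / (d |a|)]. *)
Lemma near_maximum_bound (f : C -> C) (L : nat) (R0 d : R) (a s c : C) :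
  10000000 <= INR L -> 0 < Cmod a -> 0 < d -> d <= 4 * Cmod a -> R0 = Cmod a + d ->
  (forall z, Cmod z <= R0 ->
    Cmod (f z) * (R0 - Cmod z) ^ L <= (1 + 1 / 4000) * (Cmod (f a) * d ^ L)) ->
  c = (RtoC (INR L / (d * Cmod a)) * Cconj a)%C ->
  Cmod s <= 12 * d / INR L ->
  Cmod (f (a + s)%C) <= (1 + 1 / 1000) * Cmod (f a) * exp (fst (c * s)%C).
Proof.
  intros HL Ha Hd Hda HR Hmax Hc Hs.
  set (l := INR L) in *. set (m := Cmod a) in *.
  set (t := fst (Cconj a * s)%C).
  set (x := t / (m * d)). set (k := / l).
  assert (Hk : 0 < k <= 1 / 10000000).
  { unfold k. split; [apply Rinv_0_lt_compat; lra|].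
    apply Rmult_le_reg_r with l; [lra|]. rewrite Rinv_l; lra. }
  assert (Hkl : k * l = 1) by (unfold k; apply Rinv_l; lra).
  set (q := Cmod s) in *. assert (Hq0 : 0 <= q) by apply Cmod_ge_0.
  assert (Hq : q <= 12 * k * d) by (unfold k; unfold Rdiv in Hs; lra).
  assert (Ht : Rabs t <= m * q).
  { apply Rle_trans with (1 := abs_fst_le _). rewrite Cmod_mult, Cmod_conj. unfold m, q. lra. }
  assert (Etx : t = m * d * x) by (unfold x; field; lra).
  assert (Hmd : 0 < m * d) by nra.
  assert (Hx : Rabs x <= 12 * k).
  { apply Rmult_le_reg_l with (m * d); [assumption|].
    rewrite <- (Rabs_pos_eq (m * d)) at 1 by lra. rewrite <- Rabs_mult, <- Etx.
    apply Rle_trans with (1 := Ht). nra. }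
  apply Rabs_le_between in Hx.
  (* [d x] is the radial component of [s]; the correction pays for its second-order part, since [|s|
     ^ 2 <= 144 k ^ 2 d ^ 2 <= 2 m d * 288 k ^ 2] by [d <= 4 m]. *)
  set (y := x + 288 * (k * k)).
  assert (Hkk : 0 <= 288 * (k * k) <= k) by nra.
  assert (Hy : - (13 * k) <= y <= 13 * k) by (unfold y; lra).
  assert (Hdist : Cmod (a + s) <= m + d * y).
  { assert (Hpos : 0 <= m + d * y) by nra.
    apply Rsqr_incr_0_var; [|assumption]. unfold Rsqr. rewrite Cmod_add_sqr.
    fold m. fold q. fold t. rewrite Etx.
    assert (Hqq : q * q <= 576 * (k * k) * (m * d)).
    { apply Rle_trans with ((12 * k * d) * (12 * k * d)); [apply Rmult_le_compat; lra|].
      replace (12 * k * d * (12 * k * d)) with (144 * (k * k) * d * d) by ring.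
      replace (576 * (k * k) * (m * d)) with (144 * (k * k) * d * (4 * m)) by ring.
      apply Rmult_le_compat_l; [|lra]. apply Rmult_le_pos; nra. }
    unfold y. assert (0 <= (d * y) * (d * y)) by (apply Rle_0_sqr). unfold y in H. nra. }
  assert (Hin : Cmod (a + s) <= R0) by nra.
  assert (Hw : d * (1 - y) <= R0 - Cmod (a + s)) by (rewrite HR; lra).
  specialize (Hmax (a + s)%C Hin).
  assert (Pd : 0 < d ^ L) by now apply pow_lt.
  assert (Hy2 : Rabs y <= 1 / 2) by (apply Rabs_le; lra).
  assert (Hexp := exp_le_one_sub_pow y L Hy2). fold l in Hexp.
  set (u := Cmod (f (a + s)%C)) in *. assert (Hu : 0 <= u) by apply Cmod_ge_0.
  assert (Hv : 0 <= Cmod (f a)) by apply Cmod_ge_0. set (v := Cmod (f a)) in *.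
  set (w := (1 - y) ^ L) in *.
  assert (Hw0 : 0 < w) by (apply pow_lt; lra).
  assert (H1 : u * w <= (1 + 1 / 4000) * v).
  { apply Rmult_le_reg_r with (d ^ L); [assumption|].
    rewrite (Rmult_assoc _ v). apply Rle_trans with (2 := Hmax).
    rewrite Rmult_assoc. apply Rmult_le_compat_l; [assumption|].
    unfold w. rewrite <- Rpow_mult_distr. apply pow_incr. split; [apply Rmult_le_pos; lra | lra]. }
  set (E := exp (l * (y + 2 * (y * y)))) in *.
  assert (HE : 0 < E) by apply exp_pos.
  assert (H2 : u <= (1 + 1 / 4000) * v * E).
  { apply Rle_trans with (u * (E * w)); [nra|].
    replace (u * (E * w)) with (u * w * E) by ring. apply Rmult_le_compat_r; lra. }
  assert (Ecs : fst (c * s)%C = l * x).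
  { rewrite Hc. unfold x, t. unfold Cmult, RtoC, Cconj; simpl. fold l. fold m. field.
    split; lra. }
  assert (H3 : E <= exp (l * x) * (1 + 1 / 2000)).
  { unfold E. replace (l * (y + 2 * (y * y))) with (l * x + (l * (y + 2 * (y * y)) - l * x)) by ring.
    rewrite exp_plus. apply Rmult_le_compat_l; [left; apply exp_pos|].
    set (e := l * (y + 2 * (y * y)) - l * x).
    (* [626 = 288 + 2 * 13 ^ 2]. With [k <= 10 ^ -7] this excess in the exponent costs less than the
       factor [1 + 1 / 2000]. *)
    assert (He : 0 <= e <= 626 * k).
    { assert (Hyy : 0 <= y * y <= 169 * (k * k)) by nra.
      assert (Ee : e = l * (288 * (k * k) + 2 * (y * y))) by (unfold e, y; ring).
      rewrite Ee. split; [apply Rmult_le_pos; nra|].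
      replace (626 * k) with (l * (626 * (k * k))).
      - apply Rmult_le_compat_l; lra.
      - replace (l * (626 * (k * k))) with (626 * k * (k * l)) by ring. rewrite Hkl. ring. }
    assert (Q := exp_quadratic_upper e ltac:(rewrite Rabs_pos_eq; lra)).
    apply Rle_trans with (1 := Q). nra. }
  rewrite Ecs. apply Rle_trans with (1 := H2).
  apply Rle_trans with ((1 + 1 / 4000) * v * (exp (l * x) * (1 + 1 / 2000))).
  - apply Rmult_le_compat_l; [apply Rmult_le_pos; lra | assumption].
  - replace ((1 + 1 / 4000) * v * (exp (l * x) * (1 + 1 / 2000)))
      with ((1 + 1 / 4000) * (1 + 1 / 2000) * (v * exp (l * x))) by ring.
    rewrite (Rmult_assoc _ v). apply Rmult_le_compat_r; [|lra].
    apply Rmult_le_pos; [assumption | left; apply exp_pos].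
Qed.

(** If [|a| < R / 4], superpolynomial growth yields [w] with [|w| <= R / 2] and
    [|f w| >= 2 ^ (L + 1) |f a|]. Passing from [a] to [w] loses at most [2 ^ L] in the weight, so
    the product would double, contradicting near-maximality. *)
Lemma near_maximum_exists (f : C -> C) (L : nat) (A : R) : centire f -> ~ is_polynomial f ->
  (1 <= L)%nat -> 0 < A ->
  exists R0, 0 < R0 /\ forall R, R0 <= R -> exists a,
    R / 4 <= Cmod a < R /\ A * R <= Cmod (f a) /\
    forall z, Cmod z <= R ->
      Cmod (f z) * (R - Cmod z) ^ L <= (1 + 1 / 4000) * (Cmod (f a) * (R - Cmod a) ^ L).
Proof.
  intros Hf Hp HL HA.
  assert (P2 : 0 < 2 ^ L) by (apply pow_lt; lra).
  (* At radius [R / 4] this gives [|f w| >= 2 * 2 ^ L * A * R], and near-maximality gives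
     [|f a| >= |f w| / (2 * 2 ^ L)]. *)
  destruct (superpolynomial_growth f (S L) (8 * A * 2 ^ L) Hf Hp) as [r0 [Hr0 Hg]].
  exists (4 * r0). split; [lra|]. intros R HR.
  destruct (Hg (R / 4) ltac:(lra)) as [w [Hw [Hwm Hwa]]].
  set (Phi := fun z => Cmod (f z) * (R - Cmod z) ^ L).
  destruct (ccont_bounded f R (fun z => ccont_of_cdiff f z (Hf z))) as [B HB].
  assert (Hbd : forall z, Cmod z <= R -> Phi z <= B * R ^ L).
  { intros z Hz. assert (Q := Cmod_ge_0 z).
    apply Rmult_le_compat; [apply Cmod_ge_0 | apply pow_le; lra | now apply HB | apply pow_incr; lra]. }
  destruct (sup_exists Phi (fun z => Cmod z <= R) (B * R ^ L) w ltac:(lra) Hbd) as [M [HM HM']].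
  assert (PR : 0 < (R / 2) ^ L) by (apply pow_lt; lra).
  assert (PAR : 0 < A * 2 ^ L * R) by (repeat apply Rmult_lt_0_compat; lra).
  assert (Hfw : 0 < Cmod (f w)) by lra.
  assert (Hlow : Cmod (f w) * (R / 2) ^ L <= M).
  { apply Rle_trans with (2 := HM w ltac:(lra)).
    apply Rmult_le_compat_l; [lra|]. apply pow_incr. lra. }
  assert (Hprod : 0 < Cmod (f w) * (R / 2) ^ L) by now apply Rmult_lt_0_compat.
  destruct (HM' (M / (1 + 1 / 4000))) as [a [Ha Haphi]]; [lra|].
  assert (HMa : M <= (1 + 1 / 4000) * Phi a) by lra.
  assert (HPa : 0 < Phi a) by lra.
  assert (Hmax : forall z, Cmod z <= R -> Phi z <= (1 + 1 / 4000) * Phi a)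
    by (intros z Hz; apply Rle_trans with (1 := HM z Hz), HMa).
  assert (HaR : Cmod a < R).
  { destruct (Rle_lt_or_eq_dec _ _ Ha) as [H|H]; [assumption|].
    unfold Phi in HPa. rewrite H, Rminus_diag in HPa. rewrite pow_i in HPa by lia. lra. }
  assert (Hfa : 0 <= Cmod (f a)) by apply Cmod_ge_0.
  assert (Qa := Cmod_ge_0 a).
  assert (PRL : 0 < R ^ L) by (apply pow_lt; lra).
  assert (Hup : Phi a <= Cmod (f a) * R ^ L).
  { apply Rmult_le_compat_l; [assumption | apply pow_incr; lra]. }
  assert (E2 : R ^ L = 2 ^ L * (R / 2) ^ L) by (rewrite <- Rpow_mult_distr; f_equal; field).
  exists a. split; [split; [|assumption] | split; [|exact Hmax]].
  - apply Rnot_lt_le. intros Hlt.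
    specialize (Hwm a ltac:(lra)). simpl in Hwm.
    assert (K : 2 * (Cmod (f a) * R ^ L) <= Cmod (f w) * (R / 2) ^ L).
    { rewrite E2. replace (2 * (Cmod (f a) * (2 ^ L * (R / 2) ^ L)))
        with (2 * 2 ^ L * Cmod (f a) * (R / 2) ^ L) by ring.
      apply Rmult_le_compat_r; lra. }
    lra.
  - assert (K : Cmod (f w) * (R / 2) ^ L <= 2 * 2 ^ L * Cmod (f a) * (R / 2) ^ L).
    { replace (2 * 2 ^ L * Cmod (f a) * (R / 2) ^ L) with (2 * (Cmod (f a) * R ^ L)) by (rewrite E2; ring).
      lra. }
    apply Rmult_le_reg_r in K; [|assumption].
    apply Rmult_le_reg_l with (2 * 2 ^ L); lra.
Qed.

(** The control of [g] is stated as a Lipschitz bound because the slope of [f] on small discs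
    depends on differences of [g]; closeness to 1 follows from [g 0 = 1]. The constant obtained is
    [8 / 12] of the one claimed. *)
Lemma exponential_like_point (f : C -> C) (A : R) : centire f -> ~ is_polynomial f -> 0 < A ->
  exists R0, 0 < R0 /\ forall R, R0 <= R -> exists (a c : C) (g : C -> C),
    R / 4 <= Cmod a <= R /\ A * R <= Cmod (f a) /\ c <> 0%C /\ 1000000 <= Cmod c * Cmod a /\
    (forall s, f (a + s)%C = (f a * cexp (c * s) * g s)%C) /\ g 0%C = 1%C /\
    forall s t, Cmod s <= 6 / Cmod c -> Cmod t <= 6 / Cmod c ->
      Cmod (g s - g t) <= 1 / 1000 * Cmod c * Cmod (s - t).
Proof.
  intros Hf Hp HA.
  destruct (INR_unbounded 10000000) as [L HL].
  assert (HL1 : (1 <= L)%nat) by (apply INR_le; simpl; lra).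
  destruct (near_maximum_exists f L A Hf Hp HL1 HA) as [R0 [HR0 H]].
  exists R0. split; [assumption|]. intros R HR.
  destruct (H R HR) as [a [[Ha1 Ha2] [Hfa Hmax]]].
  set (d := R - Cmod a) in *.
  set (c := (RtoC (INR L / (d * Cmod a)) * Cconj a)%C).
  assert (Hd : 0 < d) by (unfold d; lra).
  assert (Ha0 : 0 < Cmod a) by lra.
  assert (Hc : Cmod c = INR L / d).
  { unfold c. rewrite Cmod_mult, Cmod_conj, Cmod_RtoC_pos by (apply Rdiv_le_0_compat; nra).
    field. lra. }
  assert (Hc0 : 0 < Cmod c) by (rewrite Hc; apply Rdiv_lt_0_compat; lra).
  assert (Nc : c <> 0%C) by now apply Cmod_gt_0.
  assert (Hfa0 : 0 < Cmod (f a)) by (apply Rlt_le_trans with (2 := Hfa); nra).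
  assert (Nfa : f a <> 0%C) by now apply Cmod_gt_0.
  exists a, c, (fun s => f (a + s) * (cexp (- (c * s)) * / f a))%C.
  split; [lra|]. split; [assumption|]. split; [assumption|]. split.
  (* [|c| |a| = L |a| / d], where [d <= 3 |a|] since [|a| >= R / 4]. Hence the scale [1 / |c|] is
     tiny compared with [|a|]. *)
  { rewrite Hc. apply Rmult_le_reg_r with d; [assumption|].
    replace (INR L / d * Cmod a * d) with (INR L * Cmod a) by (field; lra).
    unfold d. nra. }
  split; [|split].
  - intros s. replace (f a * cexp (c * s) * (f (a + s) * (cexp (- (c * s)) * / f a)))%C
      with (f (a + s) * (cexp (c * s) * cexp (- (c * s))) * (f a * / f a))%C by ring.
    rewrite cexp_opp, Cinv_r by assumption. ring.
  - rewrite Cplus_0_r. replace (- (c * 0))%C with (RtoC 0) by ring. rewrite cexp_0, Cmult_1_l.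
    now apply Cinv_r.
  - set (g := fun s => (f (a + s) * (cexp (- (c * s)) * / f a))%C).
    assert (Dg : centire g).
    { intros z. apply cdiff_mult; [|apply cdiff_mult; [|apply cdiff_const]].
      - apply (cdiff_comp f (fun s => a + s)%C); [apply Hf|].
        apply cdiff_plus; [apply cdiff_const | apply cdiff_id].
      - apply (cdiff_comp cexp (fun s => - (c * s))%C); [apply cdiff_cexp|].
        apply cdiff_ext with (2 := cdiff_affine 0 (- c) z). intros w. ring. }
    assert (B : forall z, Cmod z = 12 / Cmod c -> fst (g z) <= 1 + 1 / 1000).
    { intros z Hz. apply Rle_trans with (1 := Rle_abs _), Rle_trans with (1 := abs_fst_le _).
      unfold g. rewrite !Cmod_mult, Cmod_cexp, Cmod_inv by assumption.
      assert (K := near_maximum_bound f L R d a z c ltac:(lra) Ha0 Hd ltac:(unfold d; lra)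
        ltac:(unfold d; ring) Hmax eq_refl ltac:(rewrite Hz, Hc; right; field; lra)).
      replace (fst (- (c * z))%C) with (- fst (c * z)%C) by reflexivity.
      rewrite exp_Ropp. assert (P := exp_pos (fst (c * z)%C)).
      apply Rmult_le_reg_r with (Cmod (f a) * exp (fst (c * z)%C)); [nra|].
      replace (Cmod (f (a + z)%C) * (/ exp (fst (c * z)%C) * / Cmod (f a)) * (Cmod (f a) * exp (fst (c * z)%C)))
        with (Cmod (f (a + z)%C)) by (field; lra).
      lra. }
    assert (Hrho : 0 < 12 / Cmod c) by (apply Rdiv_lt_0_compat; lra).
    assert (G0 : g 0%C = 1%C).
    { unfold g. rewrite Cplus_0_r. replace (- (c * 0))%C with (RtoC 0) by ring.
      rewrite cexp_0, Cmult_1_l. now apply Cinv_r. }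
    intros s t Hs Ht.
    apply Rle_trans with (1 := lipschitz_of_re_bound g _ _ Dg Hrho G0 B s t
      ltac:(lra) ltac:(lra)).
    apply Rmult_le_compat_r; [apply Cmod_ge_0|].
    replace (8 * (1 / 1000) / (12 / Cmod c)) with (8 / 12 * (1 / 1000) * Cmod c) by (field; lra).
    lra.
Qed.

(** * Expanding discs and the escaping orbit *)

Lemma ln_quarter_bound (x : R) : 1 / 4 <= x <= 1 -> Rabs (ln x) <= 3 / 2.
Proof.
  intros Hx. 
  assert (H1 : ln x <= ln 1) by (destruct (Rle_lt_or_eq_dec x 1) as [H|H]; [lra | left; apply ln_increasing; lra | rewrite H; lra]).
  rewrite ln_1 in H1. rewrite Rabs_left1 by assumption.
  apply Rnot_lt_le. intros L.
  assert (E : exp (ln x) < exp (- (3 / 2))) by (apply exp_increasing; lra).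
  rewrite exp_ln in E by lra. rewrite exp_Ropp in E.
  (* [ln 4 <= 3 / 2] is obtained from [exp (3 / 2) >= (9 / 8) ^ 12 >= 4]. *)
  assert (B := exp_ge_linear (1 / 8)).
  assert (E12 : exp (3 / 2) = exp (1 / 8) ^ 12)
    by (rewrite <- exp_INR_mult; f_equal; simpl; field).
  assert (B12 : (9 / 8) ^ 12 <= exp (1 / 8) ^ 12) by (apply pow_incr; lra).
  assert (B4 : 4 <= exp (3 / 2)) by (rewrite E12; apply Rle_trans with (2 := B12); simpl; lra).
  assert (I : / exp (3 / 2) <= / 4) by (apply Rinv_le_contravar; lra).
  lra.
Qed.

(** Near 0 the map [tau -> cexp tau * G] has slope close to 1 when [G] is close to 1 and varies
    slowly. The four error terms together stay below a third of [|tau - tau'|]. *)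
Lemma cexp_mult_lipschitz (tau tau' G G' : C) :
  Cmod tau <= 1 / 32 -> Cmod tau' <= 1 / 32 -> Cmod (G - 1) <= 6 / 1000 ->
  Cmod (G - G') <= 1 / 1000 * Cmod (tau - tau') ->
  Cmod (cexp tau * G - cexp tau' * G' - (tau - tau')) <= 1 / 2 * Cmod (tau - tau').
Proof.
  intros Ht Ht' HG HGG. set (h := (tau - tau')%C) in *.
  assert (Hh : Cmod h <= 1 / 16) by (unfold h; apply Rle_trans with (1 := Cmod_sub_triangle _ _); lra).
  assert (Qh := Cmod_ge_0 h). assert (Qt := Cmod_ge_0 tau').
  assert (E : cexp tau = (cexp tau' * cexp h)%C)
    by (rewrite <- cexp_plus; f_equal; unfold h; ring).
  set (r := (cexp h - 1 - h)%C).
  assert (Hr : Cmod r <= 1 / 4 * Cmod h).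
  { apply Rle_trans with (1 := cexp_quadratic h ltac:(lra)). nra. }
  set (r' := (cexp tau' - 1 - tau')%C).
  assert (Hr' : Cmod r' <= 1 / 8 * Cmod tau').
  { apply Rle_trans with (1 := cexp_quadratic tau' ltac:(lra)). nra. }
  set (e := cexp tau') in *.
  assert (He1 : Cmod (e - 1) <= 9 / 256).
  { replace (e - 1)%C with (r' + tau')%C by (unfold r'; ring).
    apply Rle_trans with (1 := Cmod_triangle _ _). lra. }
  assert (He : Cmod e <= 265 / 256).
  { assert (T := Cmod_triangle_rev e 1). rewrite Cmod_1 in T. lra. }
  assert (Qe := Cmod_ge_0 e).
  rewrite E.
  replace (e * cexp h * G - e * G' - h)%C
    with (e * r + (e - 1) * h + (e * (r + h) * (G - 1) + e * (G - G')))%C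
    by (unfold r; ring).
  apply Rle_trans with (1 := Cmod_triangle _ _).
  apply Rle_trans with (1 := Rplus_le_compat _ _ _ _ (Cmod_triangle _ _) (Cmod_triangle _ _)).
  rewrite !Cmod_mult.
  assert (B1 : Cmod e * Cmod r <= 265 / 256 * (1 / 4 * Cmod h))
    by (apply Rmult_le_compat; try assumption; apply Cmod_ge_0).
  assert (B2 : Cmod (e - 1) * Cmod h <= 9 / 256 * Cmod h) by (apply Rmult_le_compat_r; lra).
  assert (B3 : Cmod (r + h) <= 5 / 4 * Cmod h)
    by (apply Rle_trans with (1 := Cmod_triangle _ _); lra).
  assert (B4 : Cmod e * Cmod (r + h) <= 265 / 256 * (5 / 4 * Cmod h))
    by (apply Rmult_le_compat; try assumption; apply Cmod_ge_0).
  assert (B5 : Cmod e * Cmod (r + h) * Cmod (G - 1) <= 265 / 256 * (5 / 4 * Cmod h) * (6 / 1000))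
    by (apply Rmult_le_compat; try assumption; [apply Rmult_le_pos; apply Cmod_ge_0 | apply Cmod_ge_0]).
  assert (B6 : Cmod e * Cmod (G - G') <= 265 / 256 * (1 / 1000 * Cmod h))
    by (apply Rmult_le_compat; try assumption; apply Cmod_ge_0).
  lra.
Qed.

(** With [cexp s0 = a' / f a] and [b = a + s0 / c], one has [f z = a' * cexp (c * (z - b)) * g (z -
    a)]. Since [|s0| <= 11 / 2], the disc of radius [1 / (32 |c|)] about [b] stays inside the disc
    of radius [6 / |c|] about [a], and there [|g - 1| <= 6 / 1000]. *)
Lemma expanding_disc (f : C -> C) (a c a' : C) (g : C -> C) : c <> 0%C ->
  f a <> 0%C -> Cmod (f a) / 4 <= Cmod a' <= Cmod (f a) ->
  (forall s, f (a + s)%C = (f a * cexp (c * s) * g s)%C) -> g 0%C = 1%C ->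
  (forall s t, Cmod s <= 6 / Cmod c -> Cmod t <= 6 / Cmod c ->
    Cmod (g s - g t) <= 1 / 1000 * Cmod c * Cmod (s - t)) ->
  exists b, Cmod (b - a) <= 11 / 2 / Cmod c /\ Cmod (f b - a') <= 6 / 1000 * Cmod a' /\
    forall z w, Cmod (z - b) <= 1 / (32 * Cmod c) -> Cmod (w - b) <= 1 / (32 * Cmod c) ->
      Cmod (f z - f w - a' * c * (z - w)) <= 1 / 2 * Cmod (a' * c) * Cmod (z - w).
Proof.
  intros Hc Hfa Ha' Hfg Hg0 Hg.
  assert (Pc := proj1 (Cmod_gt_0 c) Hc). assert (Pf := proj1 (Cmod_gt_0 _) Hfa).
  set (m := Cmod c) in *.
  assert (Na' : a' <> 0%C) by (apply Cmod_gt_0; lra).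
  destruct (polar_form (a' / f a)) as [s0 [Es0 [Hre Him]]].
  { apply Cmod_gt_0. rewrite Cmod_div by assumption. apply Rdiv_lt_0_compat; lra. }
  assert (Hs0 : Cmod s0 <= 11 / 2).
  { apply Rle_trans with (1 := Cmod_le_abs _). rewrite Hre, Cmod_div by assumption.
    assert (L := ln_quarter_bound (Cmod a' / Cmod (f a))). assert (P4 := PI_4).
    apply Rle_trans with (3 / 2 + 4); [|lra]. apply Rplus_le_compat; [|lra].
    apply L. split; apply Rmult_le_reg_r with (Cmod (f a)); try assumption;
      unfold Rdiv; rewrite ?(Rmult_assoc (Cmod a')), ?Rinv_l; lra. }
  set (b := (a + s0 / c)%C). exists b.
  assert (Eba : (b - a = s0 / c)%C) by (unfold b; ring).
  assert (Hba : Cmod (b - a) <= 11 / 2 / m).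
  { rewrite Eba, Cmod_div by assumption. fold m.
    apply Rmult_le_compat_r; [left; now apply Rinv_0_lt_compat | assumption]. }
  split; [assumption|].
  assert (Ez : forall z, f z = (a' * (cexp (c * (z - b)) * g (z - a)))%C).
  { intros z. replace z with (a + (z - a))%C at 1 by ring. rewrite Hfg.
    replace (c * (z - a))%C with (s0 + c * (z - b))%C by (unfold b; field; assumption).
    rewrite cexp_plus, Es0. field. assumption. }
  assert (Hnear : forall z, Cmod (z - b) <= 1 / (32 * m) -> Cmod (z - a) <= 6 / m).
  { intros z Hz. replace (z - a)%C with ((z - b) + (b - a))%C by ring.
    apply Rle_trans with (1 := Cmod_triangle _ _).
    apply Rle_trans with (1 / (32 * m) + 11 / 2 / m); [lra|].
    apply Rmult_le_reg_r with m; [assumption|].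
    replace ((1 / (32 * m) + 11 / 2 / m) * m) with (1 / 32 + 11 / 2) by (field; lra).
    replace (6 / m * m) with 6 by (field; lra). lra. }
  assert (Hg1 : forall z, Cmod (z - b) <= 1 / (32 * m) -> Cmod (g (z - a)%C - 1) <= 6 / 1000).
  { intros z Hz. rewrite <- Hg0. assert (K := Hnear z Hz).
    apply Rle_trans with (1 := Hg (z - a)%C 0%C K ltac:(rewrite Cmod_0; apply Rdiv_le_0_compat; lra)).
    replace (z - a - 0)%C with (z - a)%C by ring.
    apply Rle_trans with (1 / 1000 * m * (6 / m)); [apply Rmult_le_compat_l; lra|].
    right. field. lra. }
  assert (Hpos : 0 <= 1 / (32 * m)) by (apply Rdiv_le_0_compat; lra).
  split.
  - rewrite Ez. replace (c * (b - b))%C with (RtoC 0) by ring. rewrite cexp_0.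
    replace (a' * (1 * g (b - a)%C) - a')%C with (a' * (g (b - a)%C - 1))%C by ring.
    rewrite Cmod_mult, Rmult_comm. apply Rmult_le_compat_r; [apply Cmod_ge_0|].
    apply Hg1. replace (b - b)%C with (RtoC 0) by ring. rewrite Cmod_0. assumption.
  - intros z w Hz Hw.
    assert (Hct : forall z, Cmod (z - b) <= 1 / (32 * m) -> Cmod (c * (z - b)) <= 1 / 32).
    { intros u Hu. rewrite Cmod_mult. fold m.
      apply Rle_trans with (m * (1 / (32 * m))); [apply Rmult_le_compat_l; lra | right; field; lra]. }
    rewrite (Ez z), (Ez w).
    replace (a' * (cexp (c * (z - b)) * g (z - a)%C) - a' * (cexp (c * (w - b)) * g (w - a)%C) - a' * c * (z - w))%C
      with (a' * (cexp (c * (z - b)) * g (z - a)%C - cexp (c * (w - b)) * g (w - a)%C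
                  - (c * (z - b) - c * (w - b))))%C by ring.
    assert (K := cexp_mult_lipschitz (c * (z - b)) (c * (w - b)) (g (z - a)%C) (g (w - a)%C)
      (Hct z Hz) (Hct w Hw) (Hg1 z Hz)).
    replace (c * (z - b) - c * (w - b))%C with (c * (z - w))%C in * by ring.
    rewrite !Cmod_mult in *. fold m in K |- *.
    replace (1 / 2 * (Cmod a' * m) * Cmod (z - w)) with (Cmod a' * (1 / 2 * (m * Cmod (z - w)))) by ring.
    apply Rmult_le_compat_l; [apply Cmod_ge_0|]. apply K.
    apply Rle_trans with (1 := Hg _ _ (Hnear z Hz) (Hnear w Hw)).
    replace (z - a - (w - a))%C with (z - w)%C by ring. lra.
Qed.

(** The intervals about [x k] of radius [4 r (3/4) ^ k] are nested, because this radius shrinks by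
    exactly [r (3/4) ^ k] at each step. *)
Lemma geometric_cauchy_real (x : nat -> R) (r : R) : 0 <= r ->
  (forall k, Rabs (x (S k) - x k) <= (3 / 4) ^ k * r) ->
  exists l, forall k, Rabs (x k - l) <= 4 * r * (3 / 4) ^ k.
Proof.
  intros Hr H.
  destruct (nested_intervals (fun k => x k - 4 * r * (3 / 4) ^ k) (fun k => x k + 4 * r * (3 / 4) ^ k))
    as [l Hl].
  - intros k. specialize (H k). apply Rabs_le_between in H. simpl.
    assert (0 <= r * (3 / 4) ^ k) by (apply Rmult_le_pos; [assumption | apply pow_le; lra]).
    lra.
  - exists l. intros k. specialize (Hl k). apply Rabs_le. lra.
Qed.

Lemma geometric_cauchy (u : nat -> C) (r : R) : 0 <= r ->
  (forall k, Cmod (u (S k) - u k) <= (3 / 4) ^ k * r) ->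
  exists l, forall k, Cmod (u k - l) <= 8 * r * (3 / 4) ^ k.
Proof.
  intros Hr H.
  destruct (geometric_cauchy_real (fun k => fst (u k)) r Hr) as [x Hx].
  { intros k. apply Rle_trans with (2 := H k). apply (abs_fst_le (u (S k) - u k)). }
  destruct (geometric_cauchy_real (fun k => snd (u k)) r Hr) as [y Hy].
  { intros k. apply Rle_trans with (2 := H k). apply (abs_snd_le (u (S k) - u k)). }
  exists (x, y). intros k. apply Rle_trans with (1 := Cmod_le_abs _).
  unfold Cminus, Cplus, Copp; simpl. specialize (Hx k). specialize (Hy k).
  unfold Rminus in *. simpl in *. lra.
Qed.

(* The sequence [z_(n-1)], with [z_(-1) = 0]. *)
Definition shift (z : nat -> C) (n : nat) : C := match n with O => 0%C | S m => z m end.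

(* The whole orbit is the fixed point of
   [z_n |-> z_n - (f z_n - z_(n+1) - delta z_(n-1)) / lam_n], a 3/4-contraction
   of the product of the discs [D(b_n, r_n)] for the norm [sup |z_n| / r_n]. *)
Lemma orbit_through_discs (f : C -> C) (delta : C) (b lam : nat -> C) (r : nat -> R) :
  (forall n, 0 < r n) -> (forall n, lam n <> 0%C) ->
  (forall n z w, Cmod (z - b n) <= r n -> Cmod (w - b n) <= r n ->
    Cmod (f z - f w - lam n * (z - w)) <= 1 / 2 * Cmod (lam n) * Cmod (z - w)) ->
  (forall n, Cmod (f (b n) - b (S n)) <= Cmod (lam n) * r n / 4) ->
  (forall n, r (S n) + Cmod delta * match n with O => 0 | S m => Cmod (b m) + r m end
    <= Cmod (lam n) * r n / 4) ->
  exists z : nat -> C, forall n, Cmod (z n - b n) <= r n /\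
    z (S n) = (f (z n) - delta * shift z n)%C.
Proof.
  intros Hr Hlam Hexp Hb Hsmall.
  set (T := fun (z : nat -> C) n => (z n - (f (z n) - z (S n) - delta * shift z n) / lam n)%C).
  set (Z := fun k => Nat.iter k T b).
  assert (Plam : forall n, 0 < Cmod (lam n)) by (intros n; apply Cmod_gt_0, Hlam).
  assert (Pd := Cmod_ge_0 delta).
  (* The budget [|lam n| * r n] splits into a half for the nonlinearity of [f], a quarter for the
     missed centre, and a quarter for the neighbouring terms. *)
  assert (Hin : forall k n, Cmod (Z k n - b n) <= r n).
  { induction k as [|k IH]; intros n.
    - simpl. replace (b n - b n)%C with (RtoC 0) by ring. rewrite Cmod_0. left. apply Hr.
    - change (Z (S k) n) with (T (Z k) n). unfold T. set (z := Z k) in *.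
      assert (Hbb : Cmod (b n - b n) <= r n)
        by (replace (b n - b n)%C with (RtoC 0) by ring; rewrite Cmod_0; left; apply Hr).
      assert (K := Hexp n (z n) (b n) (IH n) Hbb).
      assert (Hs : Cmod (delta * shift z n)
        <= Cmod delta * match n with O => 0 | S m => Cmod (b m) + r m end).
      { rewrite Cmod_mult. apply Rmult_le_compat_l; [assumption|].
        destruct n as [|n]; simpl; [rewrite Cmod_0; lra|].
        specialize (IH n). assert (Q := Cmod_triangle_rev (z n) (b n)). lra. }
      apply Rmult_le_reg_l with (Cmod (lam n)); [apply Plam|].
      rewrite <- Cmod_mult.
      replace (lam n * (z n - (f (z n) - z (S n) - delta * shift z n) / lam n - b n))%C
        with (- (f (z n) - f (b n) - lam n * (z n - b n)) - (f (b n) - b (S n))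
              + ((z (S n) - b (S n)) + delta * shift z n))%C by (field; apply Hlam).
      apply Rle_trans with (1 := Cmod_triangle _ _).
      apply Rle_trans with (1 := Rplus_le_compat _ _ _ _ (Cmod_sub_triangle _ _) (Cmod_triangle _ _)).
      rewrite Cmod_opp. specialize (Hb n). specialize (Hsmall n).
      assert (I1 := IH (S n)). assert (I2 := IH n).
      assert (Cmod (lam n) * Cmod (z n - b n) <= Cmod (lam n) * r n)
        by (apply Rmult_le_compat_l; [left; apply Plam | assumption]).
      lra. }
  assert (Hq : forall k, 0 < (3 / 4) ^ k) by (intros k; apply pow_lt; lra).
  (* In differences the missed centre drops out, so the factor is [1 / 2 + 1 / 4]; the bound is
     proved for all [n] at once since the step at [n] uses both neighbours. *)
  assert (Hstep : forall k n, Cmod (Z (S k) n - Z k n) <= (3 / 4) ^ k * r n).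
  { induction k as [|k IH]; intros n.
    - change (Z 1%nat n) with (T b n). change (Z 0%nat n) with (b n). unfold T.
      apply Rmult_le_reg_l with (Cmod (lam n)); [apply Plam|].
      rewrite <- Cmod_mult.
      replace (lam n * (b n - (f (b n) - b (S n) - delta * shift b n) / lam n - b n))%C
        with (- (f (b n) - b (S n)) + delta * shift b n)%C by (field; apply Hlam).
      apply Rle_trans with (1 := Cmod_triangle _ _). rewrite Cmod_opp, Cmod_mult.
      specialize (Hb n). specialize (Hsmall n). assert (Hr1 := Hr (S n)).
      assert (Cmod delta * Cmod (shift b n)
        <= Cmod delta * match n with O => 0 | S m => Cmod (b m) + r m end).
      { apply Rmult_le_compat_l; [assumption|]. destruct n as [|n]; simpl; [rewrite Cmod_0; lra|].
        specialize (Hr n). lra. }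
      assert (Hr0 := Hr n). specialize (Plam n). simpl. nra.
    - change (Z (S (S k)) n) with (T (Z (S k)) n).
      set (w := Z (S k)) in *. change (w n) with (T (Z k) n). set (z := Z k) in *. unfold T.
      assert (K := Hexp n (w n) (z n) (Hin (S k) n) (Hin k n)).
      apply Rmult_le_reg_l with (Cmod (lam n)); [apply Plam|].
      rewrite <- Cmod_mult.
      replace (lam n * (w n - (f (w n) - w (S n) - delta * shift w n) / lam n
          - (z n - (f (z n) - z (S n) - delta * shift z n) / lam n)))%C
        with (- (f (w n) - f (z n) - lam n * (w n - z n))
              + ((w (S n) - z (S n)) + delta * (shift w n - shift z n)))%C by (field; apply Hlam).
      apply Rle_trans with (1 := Cmod_triangle _ _).
      apply Rle_trans with (1 := Rplus_le_compat_l _ _ _ (Cmod_triangle _ _)).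
      rewrite Cmod_opp, Cmod_mult.
      assert (I1 := IH (S n)). assert (I2 := IH n).
      assert (S1 : Cmod (shift w n - shift z n)
        <= (3 / 4) ^ k * match n with O => 0 | S m => Cmod (b m) + r m end).
      { destruct n as [|n]; simpl shift.
        - replace (0 - 0)%C with (RtoC 0) by ring. rewrite Cmod_0. lra.
        - apply Rle_trans with (1 := IH n). apply Rmult_le_compat_l; [left; apply Hq|].
          assert (Q := Cmod_ge_0 (b n)). lra. }
      apply Rmult_le_compat_l with (r := Cmod delta) in S1; [|assumption].
      assert (S2 := Rmult_le_compat_l ((3 / 4) ^ k) _ _ (Rlt_le _ _ (Hq k)) (Hsmall n)).
      apply Rmult_le_compat_l with (r := Cmod (lam n)) in I2; [|left; apply Plam].
      simpl pow. lra. }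
  assert (Hlim : forall n, exists l, forall k, Cmod (Z k n - l) <= 8 * r n * (3 / 4) ^ k).
  { intros n. apply (geometric_cauchy (fun k => Z k n) (r n)); [left; apply Hr|].
    intros k. apply Hstep. }
  set (z := fun n => proj1_sig (constructive_indefinite_description _ (Hlim n))).
  assert (Hz : forall n k, Cmod (Z k n - z n) <= 8 * r n * (3 / 4) ^ k)
    by (intros n; exact (proj2_sig (constructive_indefinite_description _ (Hlim n)))).
  assert (Hzin : forall n, Cmod (z n - b n) <= r n).
  { intros n. apply le_epsilon. intros eps Heps.
    destruct (geometric_small (3 / 4) (8 * r n) eps ltac:(lra) Heps) as [k [_ Hk]].
    replace (z n - b n)%C with ((Z k n - b n) - (Z k n - z n))%C by ring.
    apply Rle_trans with (1 := Cmod_sub_triangle _ _).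
    specialize (Hin k n). specialize (Hz n k). lra. }
  exists z. intros n. split; [apply Hzin|].
  apply Ceq_minus, Cmod_eq_0, Rle_antisym; [|apply Cmod_ge_0].
  apply le_epsilon. intros eps Heps. rewrite Rplus_0_l.
  set (A := 8 * r (S n) + 3 / 2 * Cmod (lam n) * (8 * r n) + Cmod (lam n) * r n
    + Cmod delta * (8 * match n with O => 0 | S m => r m end)).
  destruct (geometric_small (3 / 4) A eps ltac:(lra) Heps) as [k [_ Hk]].
  apply Rle_trans with (2 := Hk).
  (* The defect of [Z k] in the recurrence is the step of the iteration scaled by [lam n], hence
     decays geometrically. *)
  assert (E : (f (Z k n) - Z k (S n) - delta * shift (Z k) n = - (lam n * (Z (S k) n - Z k n)))%C).
  { change (Z (S k) n) with (T (Z k) n). unfold T. field. apply Hlam. }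
  replace (z (S n) - (f (z n) - delta * shift z n))%C
    with (- (Z k (S n) - z (S n)) + (f (Z k n) - f (z n) - lam n * (Z k n - z n))
          + (lam n * (Z k n - z n) - (f (Z k n) - Z k (S n) - delta * shift (Z k) n)
             - delta * (shift (Z k) n - shift z n)))%C by ring.
  rewrite E.
  apply Rle_trans with (1 := Cmod_triangle _ _).
  apply Rle_trans with (1 := Rplus_le_compat _ _ _ _ (Cmod_triangle _ _) (Cmod_sub_triangle _ _)).
  apply Rle_trans with (1 := Rplus_le_compat_l _ _ _ (Rplus_le_compat_r _ _ _ (Cmod_sub_triangle _ _))).
  rewrite !Cmod_opp, !Cmod_mult.
  assert (K := Hexp n (Z k n) (z n) (Hin k n) (Hzin n)).
  assert (S1 : Cmod (shift (Z k) n - shift z n)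
    <= 8 * match n with O => 0 | S m => r m end * (3 / 4) ^ k).
  { destruct n as [|n]; simpl shift; [|apply Hz].
    replace (0 - 0)%C with (RtoC 0) by ring. rewrite Cmod_0. lra. }
  apply Rmult_le_compat_l with (r := Cmod delta) in S1; [|assumption].
  assert (H1 := Hz (S n) k).
  assert (H2 := Rmult_le_compat_l (Cmod (lam n)) _ _ (Rlt_le _ _ (Plam n)) (Hz n k)).
  assert (H3 := Rmult_le_compat_l (Cmod (lam n)) _ _ (Rlt_le _ _ (Plam n)) (Hstep k n)).
  unfold A. lra.
Qed.

Lemma henon_iter (f : C -> C) (delta : C) (z : nat -> C) :
  (forall n, z (S n) = (f (z n) - delta * shift z n)%C) ->
  forall n, Nat.iter n (henon f delta) (z O, RtoC 0) = (z n, shift z n).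
Proof.
  intros Hz. induction n as [|n IH]; [reflexivity|].
  simpl Nat.iter. rewrite IH. unfold henon; simpl. now rewrite <- Hz.
Qed.

Lemma C2_norm_ge_fst (p : C * C) : Cmod (fst p) <= @norm C_AbsRing C2 p.
Proof.
  change (@norm C_AbsRing C2 p) with (sqrt (Cmod (fst p) ^ 2 + Cmod (snd p) ^ 2)).
  rewrite <- (sqrt_pow2 (Cmod (fst p))) at 1 by apply Cmod_ge_0.
  apply sqrt_le_1_alt. assert (0 <= Cmod (snd p) ^ 2) by (apply pow_le, Cmod_ge_0). lra.
Qed.

Theorem proposition1p3 (f : C -> C) (delta : C) :
  transcendental_entire f -> delta <> RtoC 0 ->
  exists p : C * C, escaping (henon f delta) p.
Proof.
  intros [Hent Hpoly] _.
  assert (Hf : centire f) by (intros z; apply cdiff_of_ex_derive, Hent).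
  assert (Pd := Cmod_ge_0 delta).
  (* The 2 makes the radii at least double; the other summand makes [delta z_(n-1)] small compared
     with the radius of the image discs. *)
  set (A := 2 + 4000 * Cmod delta).
  destruct (exponential_like_point f A Hf Hpoly ltac:(unfold A; lra)) as [R0 [HR0 Hpt]].
  set (good := fun R (t : C * C * (C -> C)) =>
    let '(a, c, g) := t in
    R / 4 <= Cmod a <= R /\ A * R <= Cmod (f a) /\ c <> 0%C /\ 1000000 <= Cmod c * Cmod a /\
    (forall s, f (a + s)%C = (f a * cexp (c * s) * g s)%C) /\ g 0%C = 1%C /\
    forall s t, Cmod s <= 6 / Cmod c -> Cmod t <= 6 / Cmod c ->
      Cmod (g s - g t) <= 1 / 1000 * Cmod c * Cmod (s - t)).
  assert (Hex : forall R, exists t, R0 <= R -> good R t).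
  { intros R. destruct (Rle_dec R0 R) as [H|H].
    - destruct (Hpt R H) as [a [c [g Hg]]]. exists (a, c, g). intros _. exact Hg.
    (* A dummy triple makes the choice total in [R]; all radii that occur are at least [R0]. *)
    - exists (RtoC 0, RtoC 0, fun _ => RtoC 0). intros H'. contradiction. }
  set (sel := fun R => proj1_sig (constructive_indefinite_description _ (Hex R))).
  assert (Hsel : forall R, R0 <= R -> good R (sel R))
    by (intros R; exact (proj2_sig (constructive_indefinite_description _ (Hex R)))).
  (* Taking [|f (a n)|] as the next radius puts [a (S n)] exactly in the range of targets allowed by
     [expanding_disc]. *)
  set (rad := fix rad n := match n with O => R0 | S m => Cmod (f (fst (fst (sel (rad m))))) end).
  set (a := fun n => fst (fst (sel (rad n)))).
  set (c := fun n => snd (fst (sel (rad n)))).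
  set (g := fun n => snd (sel (rad n))).
  assert (Hgood : forall n, R0 <= rad n -> good (rad n) (a n, c n, g n)).
  { intros n Hn. specialize (Hsel _ Hn). unfold a, c, g.
    destruct (sel (rad n)) as [[a' c'] g']. exact Hsel. }
  assert (Hrad : forall n, R0 <= rad n).
  { induction n as [|n IH]; [simpl; lra|].
    destruct (Hgood n IH) as [_ [H _]]. change (rad (S n)) with (Cmod (f (a n))).
    unfold A in H. nra. }
  assert (HradS : forall n, A * rad n <= rad (S n)) by (intros n; apply (Hgood n (Hrad n))).
  assert (Hrad2 : forall n, 2 ^ n * R0 <= rad n).
  { induction n as [|n IH]; [simpl; lra|].
    specialize (HradS n). specialize (Hrad n). unfold A in HradS. simpl pow. nra. }
  assert (Ha : forall n, rad n / 4 <= Cmod (a n) <= rad n) by (intros n; apply (Hgood n (Hrad n))).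
  assert (Hc : forall n, c n <> 0%C) by (intros n; apply (Hgood n (Hrad n))).
  assert (Pc : forall n, 0 < Cmod (c n)) by (intros n; apply Cmod_gt_0, Hc).
  assert (Hca : forall n, / Cmod (c n) <= Cmod (a n) / 1000000).
  { intros n. assert (H : 1000000 <= Cmod (c n) * Cmod (a n)) by apply (Hgood n (Hrad n)).
    specialize (Pc n). apply Rmult_le_reg_l with (Cmod (c n)); [assumption|].
    rewrite Rinv_r by lra. lra. }
  assert (Hdisc : forall n, exists b, Cmod (b - a n) <= 11 / 2 / Cmod (c n) /\
    Cmod (f b - a (S n)) <= 6 / 1000 * Cmod (a (S n)) /\
    forall z w, Cmod (z - b) <= 1 / (32 * Cmod (c n)) -> Cmod (w - b) <= 1 / (32 * Cmod (c n)) ->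
      Cmod (f z - f w - a (S n) * c n * (z - w)) <= 1 / 2 * Cmod (a (S n) * c n) * Cmod (z - w)).
  { intros n. destruct (Hgood n (Hrad n)) as [_ [_ [_ [_ [H1 [H2 H3]]]]]].
    apply (expanding_disc f (a n) (c n) (a (S n)) (g n)); try assumption.
    - apply Hc.
    - apply Cmod_gt_0. change (0 < rad (S n)). specialize (Hrad (S n)). lra.
    - apply (Ha (S n)). }
  set (b := fun n => proj1_sig (constructive_indefinite_description _ (Hdisc n))).
  assert (Hb : forall n, Cmod (b n - a n) <= 11 / 2 / Cmod (c n) /\
    Cmod (f (b n) - a (S n)) <= 6 / 1000 * Cmod (a (S n)) /\
    forall z w, Cmod (z - b n) <= 1 / (32 * Cmod (c n)) -> Cmod (w - b n) <= 1 / (32 * Cmod (c n)) ->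
      Cmod (f z - f w - a (S n) * c n * (z - w)) <= 1 / 2 * Cmod (a (S n) * c n) * Cmod (z - w))
    by (intros n; exact (proj2_sig (constructive_indefinite_description _ (Hdisc n)))).
  set (r := fun n => 1 / (32 * Cmod (c n))).
  assert (Er : forall n, r n = / Cmod (c n) / 32)
    by (intros n; unfold r; field; apply Rgt_not_eq, Pc).
  assert (Pa : forall n, 0 < Cmod (a n)) by (intros n; specialize (Ha n); specialize (Hrad n); lra).
  assert (Hba : forall n, Cmod (b n - a n) <= 11 / 2 * (Cmod (a n) / 1000000)).
  { intros n. apply Rle_trans with (1 := proj1 (Hb n)). apply Rmult_le_compat_l; [lra | apply Hca]. }
  (* The tolerance for each of the two smallness conditions; the miss of [6 / 1000] and the distance
     from [b (S n)] to [a (S n)] fit below [1 / 128]. *)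
  assert (Hlr : forall n, Cmod (a (S n) * c n) * r n / 4 = Cmod (a (S n)) / 128).
  { intros n. rewrite Cmod_mult. unfold r. field. apply Rgt_not_eq, Pc. }
  destruct (orbit_through_discs f delta b (fun n => (a (S n) * c n)%C) r) as [z Hz].
  - intros n. rewrite Er. assert (H := Rinv_0_lt_compat _ (Pc n)). lra.
  - intros n. apply Cmult_neq_0; [apply Cmod_gt_0, Pa | apply Hc].
  - intros n z w Hz Hw. now apply (Hb n).
  - intros n. rewrite Hlr. destruct (Hb n) as [_ [H _]].
    replace (f (b n) - b (S n))%C with ((f (b n) - a (S n)) - (b (S n) - a (S n)))%C by ring.
    apply Rle_trans with (1 := Cmod_sub_triangle _ _). specialize (Hba (S n)). specialize (Pa (S n)). lra.
  - intros n. rewrite Hlr. rewrite Er. assert (H1 := Hca (S n)). assert (P1 := Pa (S n)).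
    destruct n as [|n]; [rewrite Rmult_0_r; lra|].
    assert (H2 := Hba n). assert (H3 := Hca n). rewrite Er.
    assert (H4 := Cmod_triangle_rev (b n) (a n)).
    assert (H5 : Cmod (b n) + / Cmod (c n) / 32 <= 101 / 100 * rad n)
      by (specialize (Ha n); specialize (Pa n); lra).
    apply Rmult_le_compat_l with (r := Cmod delta) in H5; [|assumption].
    (* Two growth steps and [|a| >= rad / 4] bound the [delta] term by about [|a (S (S n))| / 2000],
       well below [1 / 128]. *)
    assert (H6 : 4000 * (Cmod delta * rad n) <= rad (S n)).
    { apply Rle_trans with (2 := HradS n). unfold A. assert (0 < rad n) by (specialize (Hrad n); lra). nra. }
    assert (H7 : 2 * rad (S n) <= rad (S (S n))).
    { apply Rle_trans with (2 := HradS (S n)). unfold A.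
      assert (0 < rad (S n)) by (specialize (Hrad (S n)); lra). nra. }
    assert (H8 := proj1 (Ha (S (S n)))). lra.
  - exists (z O, RtoC 0). unfold escaping.
    (* [|a n| >= 2 ^ n * R0 / 4], and [z n] is within a few millionths of [|a n|] from [a n]; half
       of the bound is kept. *)
    apply is_lim_seq_le_p_loc with (u := fun n => R0 / 8 * 2 ^ n).
    + exists 0%nat. intros n _. rewrite (henon_iter f delta z (fun n => proj2 (Hz n))).
      apply Rle_trans with (2 := C2_norm_ge_fst _). simpl.
      destruct (Hz n) as [H _]. rewrite Er in H.
      assert (H1 := Hca n). assert (H2 := Hba n). assert (H3 := Ha n). assert (H4 := Hrad2 n).
      assert (H5 := Cmod_triangle_rev (a n) (a n - z n)).
      replace (a n - (a n - z n))%C with (z n) in H5 by ring.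
      replace (a n - z n)%C with (- (b n - a n) - (z n - b n))%C in H5 by ring.
      assert (H6 := Cmod_sub_triangle (- (b n - a n)) (z n - b n)). rewrite Cmod_opp in H6.
      specialize (Pa n). lra.
    + replace p_infty with (Rbar_mult (R0 / 8) p_infty).
      * apply is_lim_seq_scal_l, is_lim_seq_geom_p. lra.
      * apply is_Rbar_mult_unique, is_Rbar_mult_sym, is_Rbar_mult_p_infty_pos. simpl. lra.
Qed.
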